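(* Let $l>m\ge1$ be integers, $d=\gcd(l,m)$, $\gamma=(1,1)$, $\chi=l+m-2$. Given any formal system $\dot x=(-m x_1^{l}x_2^{m-1},\ l x_1^{l-1}x_2^{m})+\mathcal X(x)$ with $\mathrm{ord}_\gamma\mathcal X\ge\chi+1$ (i.e. all terms of $\mathcal X$ have ordinary degree at least $l+m$), there exists a near-identity formal transformation $x=y+\mathcal Q(y)$, $\mathrm{ord}_\gamma\mathcal Q\ge1$, that brings it into the generalized normal form (GNF) $$\begin{aligned}\dot y_1={}&-m y_1^{l}y_2^{m-1}+\sum_{k=l+m}^\infty\Bigl(\sum_{i=0}^{l-2}Y_1^{(i,k-i)}y_1^iy_2^{k-i}+\sum_{j=0}^{m-3}Y_1^{(k-j,j)}y_1^{k-j}y_2^j\Bigr)\\&+y_1^{l+2}y_2^{m-2}\sum_{i=0}^\infty Y_1^{(i+l+2,m-2)}y_1^i+y_1^{l-1}y_2^{m+1}\sum_{j=0}^\infty Y_1^{(l-1,m+j+1)}y_2^j\\&+\sum_{r=d+1}^\infty Y_1^{(rl/d,\,rm/d-1)}y_1^{rl/d}y_2^{rm/d-1}+\sum_{s=d+1+[\frac{3d-1}{l+m}]}^\infty Y_1^{(sl/d-1,\,sm/d-2)}y_1^{sl/d-1}y_2^{sm/d-2},\end{aligned}$$ $$\begin{aligned}\dot y_2={}&l y_1^{l-1}y_2^{m}+\sum_{k=l+m}^\infty\Bigl(\sum_{i=0}^{l-3}Y_2^{(i,k-i)}y_1^iy_2^{k-i}+\sum_{j=0}^{m-2}Y_2^{(k-j,j)}y_1^{k-j}y_2^j\Bigr)\\&+y_1^{l+1}y_2^{m-1}\sum_{i=0}^\infty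 Y_2^{(i+l+1,m-1)}y_1^i+y_1^{l-2}y_2^{m+2}\sum_{j=0}^\infty Y_2^{(l-2,m+j+2)}y_2^j\\&+\sum_{r=d+1}^\infty Y_2^{(rl/d-1,\,rm/d)}y_1^{rl/d-1}y_2^{rm/d}+\sum_{s=d+1+[\frac{3d-1}{l+m}]}^\infty Y_2^{(sl/d-2,\,sm/d-1)}y_1^{sl/d-2}y_2^{sm/d-1},\end{aligned}$$ where for each $i,j\ge0$, $r\ge d+1$ and $s\ge d+1+[\frac{3d-1}{l+m}]$ we take: either $Y_1^{(i+l+2,m-2)}=0$ or $Y_2^{(i+l+1,m-1)}=0$ (if $m=1$, both of these families of terms are absent); either $Y_1^{(l-1,m+j+1)}=0$ or $Y_2^{(l-2,m+j+2)}=0$; either $Y_1^{(rl/d,rm/d-1)}=0$ or $Y_2^{(rl/d-1,rm/d)}=0$; and, in case $m=1$, $Y_2^{(sl/d-2,sm/d-1)}=0$, while in case $m\ge2$, either $Y_1^{(sl/d-1,sm/d-2)}=0$ or $Y_2^{(sl/d-2,sm/d-1)}=0$. Each ''either/or'' choice is arbitrary.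
   Context: Scalars are in $\mathbb K=\mathbb R$ or $\mathbb C$; $[\,\cdot\,]$ applied to a number is the integer part. With weight $\gamma=(1,1)$, a vector polynomial $(P_1,P_2)$ has generalized degree $k$ if $P_1,P_2$ are homogeneous of degree $k+1$; $\mathfrak V_\gamma^{[k]}$ is the space of these. $\mathrm{ord}_\gamma$ of a vector formal series is the least generalized degree of its nonzero components ($+\infty$ for the zero series). Vector polynomials are identified with vector fields: $\mathcal P(f)=P_1\partial_1f+P_2\partial_2f$ and $[\mathcal P,\mathcal Q]=(\mathcal P(Q_1)-\mathcal Q(P_1),\mathcal P(Q_2)-\mathcal Q(P_2))$. $Y_i^{(p_1,p_2)}$ is the coefficient of $y_1^{p_1}y_2^{p_2}$ in the perturbation component $Y_i$; empty sums are zero. Generalized normal form. Let $\mathcal H$ be the unperturbed part (of generalized degree $\chi$). For $k\ge1$ let $n_k=\dim\mathfrak V_\gamma^{[k+\chi]}-\dim[\mathcal H,\mathfrak V_\gamma^{[k]}]$, and let $\mathbf a_1^k,\dots,\mathbf a_{n_k}^k$ be the coefficient vectors (in the standard monomial basis of $\mathfrak V_\gamma^{[k+\chi]}$) of the $n_k$ linearly independent linear conditions (resonance equations) for solvability of the homological equation $[\mathcal H,\mathcal Q_\gamma^{[k]}]=\widetilde{\mathcal Y}_\gamma^{[k+\chi]}-\mathcal Y_\gamma^{[k+\chi]}$ in $\mathcal Q_\gamma^{[k]}\in\mathfrak V_\gamma^{[k]}$, i.e. a basis of the orthogonal complement of the image $[\mathcal H,\mathfrak V_\gamma^{[k]}]$.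 A resonant set consists, for each $k\ge1$, of $n_k$ coefficients of $\mathcal Y_\gamma^{[k+\chi]}$, at positions $l_1,\dots,l_{n_k}$, such that $\det(\mathbf a^k_{i,l_j})_{i,j=1}^{n_k}\neq0$. The system $\dot y=\mathcal H(y)+\mathcal Y(y)$, $\mathrm{ord}_\gamma\mathcal Y\ge\chi+1$, is a GNF if all coefficients of $\mathcal Y$ are zero except for those from some resonant set, which have arbitrary values. Thus the claim that the displayed system is a GNF means that, for each choice made, the coefficients remaining in it form a resonant set. *)

(* Defs.v *)
From HB Require Import structures.
From mathcomp Require Import all_boot all_order all_algebra.
From mathcomp Require Import reals complex ring.

Set Implicit Arguments.
Unset Strict Implicit.
Unset Printing Implicit Defensive.

Import GRing.Theory.
Local Open Scope ring_scope.

Variant scalar_kind := RealScalars | ComplexScalars.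

Definition scalars (R : realType) (s : scalar_kind) : fieldType :=
  match s with
  | RealScalars => R
  | ComplexScalars => R[i]
  end.

(* A formal power series in two variables is given by its coefficients:
   [f a b] is the coefficient of y_1^a y_2^b. *)
Definition fps2 (K : fieldType) := nat -> nat -> K.

(* The component [ord0] is the first one (index 1), [ord_max] the second one. *)
Definition vfps2 (K : fieldType) := 'I_2 -> fps2 K.

Section FormalSeries.
Variable K : fieldType.
Implicit Types (f g : fps2 K) (F G P Q X Y : vfps2 K).

Definition fps_monom (c : K) (a b : nat) : fps2 K :=
  fun a' b' => if (a' == a) && (b' == b) then c else 0.

Definition fps_add f g : fps2 K := fun a b => f a b + g a b.

Definition fps_sub f g : fps2 K := fun a b => f a b - g a b.

Definition fps_mul f g : fps2 K := fun a b =>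
  \sum_(i < a.+1) \sum_(j < b.+1) f i j * g (a - i)%N (b - j)%N.

Definition fps_exp f (n : nat) : fps2 K := iter n (fps_mul f) (fps_monom 1 0 0).

Definition fps_deriv (e : 'I_2) f : fps2 K := fun a b =>
  if e == ord0 then f a.+1 b *+ a.+1 else f a b.+1 *+ b.+1.

Definition fps_var (e : 'I_2) : fps2 K :=
  if e == ord0 then fps_monom 1 1 0 else fps_monom 1 0 1.

(* Substitution f(phi_1, phi_2), for phi_1, phi_2 without constant term: then
   phi_1^p phi_2^q has no term of degree less than p + q, so the terms left out
   of the finite sum do not contribute to the coefficient of y_1^a y_2^b. *)
Definition fps_subst f (phi : vfps2 K) : fps2 K := fun a b =>
  \sum_(p < (a + b).+1) \sum_(q < (a + b).+1)
    f p q * fps_mul (fps_exp (phi ord0) p) (fps_exp (phi ord_max) q) a b.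

(* P(f) = P_1 d_1 f + P_2 d_2 f *)
Definition vf_apply P f : fps2 K :=
  fps_add (fps_mul (P ord0) (fps_deriv ord0 f))
          (fps_mul (P ord_max) (fps_deriv ord_max f)).

Definition vf_bracket P Q : vfps2 K := fun c =>
  fps_sub (vf_apply P (Q c)) (vf_apply Q (P c)).

(* ord_gamma F >= k for gamma = (1,1): monomials of ordinary degree n have
   generalized degree n - 1. *)
Definition ord_ge (k : nat) F : Prop :=
  forall c a b, F c a b != 0 -> (k.+1 <= a + b)%N.

Definition vfps_add F G : vfps2 K := fun c => fps_add (F c) (G c).

Definition near_identity Q : vfps2 K := fun c => fps_add (fps_var c) (Q c).

(* x = y + Q(y) takes the system x' = F(x) to y' = G(y): the derivative
   G(y_c + Q_c) of x_c along the second system is F_c(y + Q(y)). *)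
Definition transforms_into F Q G : Prop :=
  forall c a b,
    vf_apply G (near_identity Q c) a b = fps_subst (F c) (near_identity Q) a b.

(* The space of vector polynomials of generalized degree k (both components
   homogeneous of degree k + 1), in the standard monomial basis: [P c p] is the
   coefficient of y_1^p y_2^(k+1-p) in the component c. *)
Definition vpoly (k : nat) := 'M[K]_(2, k.+2).

Definition vfps_of_vpoly k (P : vpoly k) : vfps2 K := fun c a b =>
  if (a + b == k.+1)%N then P c (inord a) else 0.

Definition vpoly_of_vfps k F : vpoly k :=
  \matrix_(c, p) F c p (k.+1 - p)%N.

Section NormalForm.
(* H is the unperturbed part, of generalized degree chi. *)
Variables (H : vfps2 K) (chi : nat).

Definition homological k (Q : vpoly k) : vpoly (k + chi) :=
  vpoly_of_vfps (k + chi) (vf_bracket H (vfps_of_vpoly Q)).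

Fact homological_is_linear k : linear (@homological k).
Proof.
move=> x P Q; apply/matrixP=> c p.
have E c' a b : vfps_of_vpoly (x *: P + Q) c' a b =
    x * vfps_of_vpoly P c' a b + vfps_of_vpoly Q c' a b.
  by rewrite /vfps_of_vpoly; case: ifP=> _; rewrite ?mxE// mulr0 addr0.
have D e c' a b : fps_deriv e (vfps_of_vpoly (x *: P + Q) c') a b =
    x * fps_deriv e (vfps_of_vpoly P c') a b
    + fps_deriv e (vfps_of_vpoly Q c') a b.
  by rewrite /fps_deriv; case: ifP=> _; rewrite E mulrnDl mulrnAr.
have Ml (f g h u : fps2 K) a b : (forall i j, f i j = x * g i j + h i j) ->
    fps_mul f u a b = x * fps_mul g u a b + fps_mul h u a b.
  move=> fE; rewrite /fps_mul mulr_sumr -big_split; apply: eq_bigr=> i _ /=.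
  rewrite mulr_sumr -big_split; apply: eq_bigr=> j _ /=.
  by rewrite fE mulrDl mulrA.
have Mr (f g h u : fps2 K) a b : (forall i j, f i j = x * g i j + h i j) ->
    fps_mul u f a b = x * fps_mul u g a b + fps_mul u h a b.
  move=> fE; rewrite /fps_mul mulr_sumr -big_split; apply: eq_bigr=> i _ /=.
  rewrite mulr_sumr -big_split; apply: eq_bigr=> j _ /=.
  by rewrite fE mulrDr mulrCA.
rewrite !mxE /vf_bracket /vf_apply /fps_sub /fps_add.
do 2!rewrite (Mr _ _ _ _ _ _ (D _ _)).
do 2!rewrite (Ml _ _ _ _ _ _ (E _)).
ring.
Qed.

HB.instance Definition _ k :=
  GRing.isLinear.Build K (vpoly k) (vpoly (k + chi)) _ (@homological k)
    (@homological_is_linear k).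

Definition resonance_count (k : nat) : nat :=
  (\dim (fullv : {vspace vpoly (k + chi)})
   - \dim (limg (linfun (@homological k))))%N.

(* The a_i are the coefficient vectors of a maximal family of linearly
   independent conditions for solvability of the homological equation, i.e.
   a basis of the annihilator of the image of ad_H, for the bilinear pairing. *)
Definition resonance_basis (k : nat)
    (a : (resonance_count k).-tuple (vpoly (k + chi))) : Prop :=
  free a /\
  (forall (i : 'I_(resonance_count k)) (Q : vpoly k),
     \sum_c \sum_p tnth a i c p * homological Q c p = 0).

(* [S c a b] says that the coefficient of y_1^a y_2^b in the component c of the
   perturbation belongs to the set.  The determinant condition does not depend
   on the basis a, and it forces the positions l_j to be distinct. *)
Definition resonant_set (S : 'I_2 -> nat -> nat -> Prop) : Prop :=
  (forall c a b, S c a b -> (chi.+2 <= a + b)%N) /\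
  forall k : nat, (0 < k)%N ->
    exists (a : (resonance_count k).-tuple (vpoly (k + chi)))
           (l : 'I_(resonance_count k) -> 'I_2 * 'I_(k + chi).+2),
    [/\ resonance_basis a,
        (forall (c : 'I_2) (p : 'I_(k + chi).+2),
           S c p ((k + chi).+1 - p)%N <-> exists j, l j = (c, p)) &
        \det (\matrix_(i, j) tnth a i (l j).1 (l j).2) != 0].

End NormalForm.

(* (-m x_1^l x_2^(m-1), l x_1^(l-1) x_2^m) *)
Definition unperturbed (l m : nat) : vfps2 K := fun c =>
  if c == ord0 then fps_monom (- m%:R) l m.-1 else fps_monom l%:R l.-1 m.

End FormalSeries.

(* The coefficients of the perturbation that are kept, i.e. not set to 0.  In
   each either-or choice [true] keeps the coefficient of the first equation
   (and sets that of the second one to 0) and [false] does the opposite.  The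
   choices [cA] and [cS] play no role when m = 1. *)
Inductive kept (l m : nat) (cA cB cR cS : nat -> bool) :
    'I_2 -> nat -> nat -> Prop :=
  | Kept1_left k i of (l + m <= k)%N & (i + 2 <= l)%N :
      kept l m cA cB cR cS ord0 i (k - i)
  | Kept1_right k j of (l + m <= k)%N & (j + 3 <= m)%N :
      kept l m cA cB cR cS ord0 (k - j) j
  | Kept1_A i of (2 <= m)%N & cA i :
      kept l m cA cB cR cS ord0 (i + l + 2) (m - 2)
  | Kept1_B j of cB j :
      kept l m cA cB cR cS ord0 (l - 1) (m + j + 1)
  | Kept1_R r of (gcdn l m + 1 <= r)%N & cR r :
      kept l m cA cB cR cS ord0
        (r * (l %/ gcdn l m)) (r * (m %/ gcdn l m) - 1)
  | Kept1_S s of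
      (gcdn l m + 1 + (3 * gcdn l m - 1) %/ (l + m) <= s)%N & m = 1%N \/ cS s :
      kept l m cA cB cR cS ord0
        (s * (l %/ gcdn l m) - 1) (s * (m %/ gcdn l m) - 2)
  | Kept2_left k i of (l + m <= k)%N & (i + 3 <= l)%N :
      kept l m cA cB cR cS ord_max i (k - i)
  | Kept2_right k j of (l + m <= k)%N & (j + 2 <= m)%N :
      kept l m cA cB cR cS ord_max (k - j) j
  | Kept2_A i of (2 <= m)%N & ~~ cA i :
      kept l m cA cB cR cS ord_max (i + l + 1) (m - 1)
  | Kept2_B j of ~~ cB j :
      kept l m cA cB cR cS ord_max (l - 2) (m + j + 2)
  | Kept2_R r of (gcdn l m + 1 <= r)%N & ~~ cR r :
      kept l m cA cB cR cS ord_max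
        (r * (l %/ gcdn l m) - 1) (r * (m %/ gcdn l m))
  | Kept2_S s of
      (gcdn l m + 1 + (3 * gcdn l m - 1) %/ (l + m) <= s)%N &
      (2 <= m)%N & ~~ cS s :
      kept l m cA cB cR cS ord_max
        (s * (l %/ gcdn l m) - 2) (s * (m %/ gcdn l m) - 1).

(* Main.v *)
(* The operator [H, -] maps the span of y_1^u y_2^(v-1) d_1 and y_1^(u-1) y_2^v d_2
   to the span of y_1^U y_2^(V-1) d_1 and y_1^(U-1) y_2^V d_2, where U = u + l - 1
   and V = v + m - 1.  With w = lV - mU, the determinant of this 2 x 2 block is
   w (w + l - m); it vanishes on the two lines lV = mU and l(V+1) = m(U+1), where
   the terms indexed by r and s live.  Only one source monomial is left when u = 0
   or v = 0, which gives the terms y_1^(l-1) and y_2^(m-2), and no source monomial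
   when U < l - 1 or V < m - 1.  In each block the kept coefficients span a
   complement of the image, which is what a resonant set amounts to, and the
   transformation is then found degree by degree. *)
Require Import Defs.
From HB Require Import structures.
From mathcomp Require Import all_boot all_order all_algebra.
From mathcomp Require Import boolp reals complex ring zify.
Import GRing.Theory.
Local Open Scope ring_scope.

Set Implicit Arguments.
Unset Strict Implicit.
Unset Printing Implicit Defensive.

(** * The ring of formal power series in two variables *)

(** On a resonant line the image of a block is the kernel of a linear functional: with X and Y its
    two target coefficients, l X + m Y on the line lV = mU and (l-1) X + (m-1) Y on the line l(V+1)
    = m(U+1). A coefficient can be the kept one when its factor in the functional is nonzero. This
    makes the choices free, except that for m = 1 the second functional involves X alone, so the
    first equation must keep its term. The starting indices come from the degree: a source has
    degree u + v - 1 >= 2, so U + V >= l + m + 1. If (U, V) = r (l/d, m/d), this forces r > d. If (U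
    + 1, V + 1) = s (l/d, m/d), it says s (l + m)/d >= l + m + 3, that is (s - d)(l + m) >= 3d, that
    is s >= d + 1 + [(3d - 1)/(l + m)]. The transformation uses that the kept monomials and the
    image span; a resonant set requires in addition that they meet only in 0. *)

Section FpsRing.
Variable K : fieldType.
Implicit Types (f g h : fps2 K) (p q : {poly {poly K}}).

Let fps_of_poly p : fps2 K := fun a b => p`_a`_b.

Let trunc (n : nat) f : {poly {poly K}} := \poly_(i < n.+1) \poly_(j < n.+1) f i j.

Let fps_mul_poly p q : fps_mul (fps_of_poly p) (fps_of_poly q) = fps_of_poly (p * q).
Proof.
apply/funext=> a; apply/funext=> b; rewrite /fps_mul /fps_of_poly coefM coef_sum.
by apply: eq_bigr=> i _; rewrite coefM.
Qed.

Let fps_mul_local f f' g g' n :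
  (forall i j, (i <= n)%N -> (j <= n)%N -> f i j = f' i j) ->
  (forall i j, (i <= n)%N -> (j <= n)%N -> g i j = g' i j) ->
  forall a b, (a <= n)%N -> (b <= n)%N -> fps_mul f g a b = fps_mul f' g' a b.
Proof.
move=> ff' gg' a b an bn; rewrite /fps_mul.
apply: eq_bigr=> -[i /= ia] _; apply: eq_bigr=> -[j /= jb] _.
by rewrite ff' ?gg'//; lia.
Qed.

Let truncE n f i j : (i <= n)%N -> (j <= n)%N -> f i j = fps_of_poly (trunc n f) i j.
Proof. by move=> im jn; rewrite /fps_of_poly !coef_poly !ltnS im coef_poly ltnS jn. Qed.

(** A coefficient of a product at indices at most [n] only sees coefficients at indices at most [n],
    so the series may be truncated to polynomials, where associativity is known. *)
Fact fps_mulA : associative (@fps_mul K).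
Proof.
move=> f g h; apply/funext=> a; apply/funext=> b.
pose n := maxn a b; have an : (a <= n)%N := leq_maxl a b.
have bn : (b <= n)%N := leq_maxr a b.
pose t f := fps_of_poly (trunc n f).
have tE := @truncE n.
rewrite (@fps_mul_local f (t f) _ (fps_mul (t g) (t h)) n)//; last 2 first.
- by move=> i j ? ?; exact: tE.
- by move=> i j ? ?; apply: (@fps_mul_local _ _ _ _ n)=> // ? ? ? ?; exact: tE.
rewrite (@fps_mul_local _ (fps_mul (t f) (t g)) h (t h) n)//; last 2 first.
- by move=> i j ? ?; apply: (@fps_mul_local _ _ _ _ n)=> // ? ? ? ?; exact: tE.
- by move=> i j ? ?; exact: tE.
by rewrite !fps_mul_poly mulrA.
Qed.

Fact fps_mulC : commutative (@fps_mul K).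
Proof.
move=> f g; apply/funext=> a; apply/funext=> b.
rewrite /fps_mul (reindex_inj rev_ord_inj); apply: eq_bigr=> -[i /= ia] _.
rewrite (reindex_inj rev_ord_inj); apply: eq_bigr=> -[j /= jb] _.
by rewrite mulrC !subSS !subKn.
Qed.

Lemma fps_monom_mul (c : K) (p q : nat) f (a b : nat) :
  fps_mul (fps_monom c p q) f a b =
  if (p <= a)%N && (q <= b)%N then c * f (a - p)%N (b - q)%N else 0.
Proof.
rewrite /fps_mul /fps_monom; case: ifP=> [/andP[pa qb]|/negbT].
  rewrite (bigD1 (inord p))//= (bigD1 (inord q))//= !inordK ?ltnS// !eqxx /=.
  rewrite !big1 ?addr0// => -[i /= ia]; rewrite -(inj_eq val_inj) /= inordK ?ltnS// => ip.
    by rewrite big1// => j _; rewrite (negbTE ip) mul0r.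
  by rewrite (negbTE ip) mul0r.
rewrite negb_and=> pq; rewrite big1// => -[i /= ia] _; rewrite big1// => -[j /= jb] _.
by case: eqP=> [ip|]; case: eqP=> [jq|]/=; rewrite ?mul0r//; move: pq; lia.
Qed.

Fact fps_mul1 : left_id (fps_monom 1 0 0 : fps2 K) (@fps_mul K).
Proof. by move=> f; apply/funext=> a; apply/funext=> b;
    rewrite fps_monom_mul !subn0 mul1r. Qed.

Fact fps_mulDl : left_distributive (@fps_mul K) (@fps_add K).
Proof.
move=> f g h; apply/funext=> a; apply/funext=> b; rewrite /fps_add /fps_mul -big_split.
apply: eq_bigr=> i _ /=; rewrite -big_split; apply: eq_bigr=> j _ /=; exact: mulrDl.
Qed.

Fact fps_addA : associative (@fps_add K).
Proof. by move=> f g h; apply/funext=> a; apply/funext=> b; exact: addrA. Qed.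

Fact fps_addC : commutative (@fps_add K).
Proof. by move=> f g; apply/funext=> a; apply/funext=> b; exact: addrC. Qed.

Fact fps_add0 : left_id (fun _ _ => 0 : K) (@fps_add K).
Proof. by move=> f; apply/funext=> a; apply/funext=> b; exact: add0r. Qed.

Fact fps_addN : left_inverse (fun _ _ => 0 : K) (fun f a b => - f a b) (@fps_add K).
Proof. by move=> f; apply/funext=> a; apply/funext=> b; exact: addNr. Qed.

Fact fps_1_neq0 : fps_monom 1 0 0 != (fun _ _ => 0) :> fps2 K.
Proof.
by apply/eqP=> /(congr1 (fun f : fps2 K => f 0%N 0%N))/eqP; rewrite /fps_monom oner_eq0.
Qed.

(** With classical equality and choice, series form a commutative ring, and [ring] can settle the
    identities between them below. *)
HB.instance Definition _ := gen_eqMixin (fps2 K).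
HB.instance Definition _ := gen_choiceMixin (fps2 K).
HB.instance Definition _ := GRing.isZmodule.Build (fps2 K)
  fps_addA fps_addC fps_add0 fps_addN.
HB.instance Definition _ := GRing.Zmodule_isComNzRing.Build (fps2 K)
  fps_mulA fps_mulC fps_mul1 fps_mulDl fps_1_neq0.

Lemma fps_addE f g : fps_add f g = f + g. Proof. by []. Qed.
Lemma fps_mulE f g : fps_mul f g = f * g. Proof. by []. Qed.

Lemma fps_expE f n : fps_exp f n = f ^+ n.
Proof. by elim: n=> // n IHn; rewrite exprS -IHn. Qed.

Lemma fpsD f g a b : (f + g) a b = f a b + g a b. Proof. by []. Qed.
Lemma fpsN f a b : (- f) a b = - f a b. Proof. by []. Qed.
End FpsRing.

(** * Orders of vanishing and first-order expansion of powers and monomials *)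

Section FpsOrder.
Variable K : fieldType.
Implicit Types (f g v d : fps2 K) (Q D X Y : vfps2 K).

(** The order is in ordinary degree, one more than the generalized degree of [ord_ge]. *)
Definition fps_ord_ge (n : nat) f := forall a b, (a + b < n)%N -> f a b = 0.

Lemma fps_ord_ge_leq n k f : (k <= n)%N -> fps_ord_ge n f -> fps_ord_ge k f.
Proof. by move=> kn fn a b ab; apply: fn; lia. Qed.

Lemma fps_ord_geD n f g : fps_ord_ge n f -> fps_ord_ge n g -> fps_ord_ge n (f + g).
Proof. by move=> fn gn a b ab; rewrite fpsD fn// gn// addr0. Qed.

Lemma fps_ord_geN n f : fps_ord_ge n f -> fps_ord_ge n (- f).
Proof. by move=> fn a b ab; rewrite fpsN fn// oppr0. Qed.

Lemma fps_ord_geB n f g : fps_ord_ge n f -> fps_ord_ge n g -> fps_ord_ge n (f - g).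
Proof. by move=> fn gn; apply/fps_ord_geD/fps_ord_geN. Qed.

Lemma fps_ord_geM i j n f g : (n <= i + j)%N ->
  fps_ord_ge i f -> fps_ord_ge j g -> fps_ord_ge n (f * g).
Proof.
move=> nij fi gj a b ab; rewrite -fps_mulE /fps_mul big1// => -[p /= pa] _.
rewrite big1// => -[q /= qb] _; have [pq|pq] := ltnP (p + q) i.
  by rewrite fi// mul0r.
by rewrite gj ?mulr0//; lia.
Qed.

Lemma fps_ord_geMn n k f : fps_ord_ge n f -> fps_ord_ge n (f *+ k).
Proof.
by move=> fn; elim: k=> [|k IHk]; rewrite ?mulr0n ?mulrS//; apply: fps_ord_geD.
Qed.

Lemma fps_ord_geX n f : fps_ord_ge 1 f -> fps_ord_ge n (f ^+ n).
Proof.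
by move=> f1; elim: n=> // n IHn; rewrite exprS; apply: (fps_ord_geM _ f1 IHn).
Qed.

Lemma fps_ord_ge_deriv e n f : fps_ord_ge n.+1 f -> fps_ord_ge n (fps_deriv e f).
Proof. by move=> fn a b ab; rewrite /fps_deriv !fn ?mul0rn ?if_same//; lia. Qed.

Lemma fps_ord_ge_monom (c : K) p q : fps_ord_ge (p + q) (fps_monom c p q).
Proof.
by move=> a b ab; rewrite /fps_monom; case: ifP=> // /andP[/eqP ? /eqP ?]; lia.
Qed.

Lemma fps_ord_ge_var e : fps_ord_ge 1 (fps_var K e).
Proof.
rewrite /fps_var; case: ifP=> _; first exact: (@fps_ord_ge_monom 1 1 0).
exact: (@fps_ord_ge_monom 1 0 1).
Qed.

(** Every term of the difference has [d] in place of at least one of the [p] factors of order 1, a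
    gain of [k]. *)
Lemma fps_ord_ge_exprB f d k p :
  fps_ord_ge 1 f -> fps_ord_ge k.+1 d -> fps_ord_ge (p + k) ((f + d) ^+ p - f ^+ p).
Proof.
move=> f1 dk; have fd1 : fps_ord_ge 1 (f + d) by apply/fps_ord_geD/(fps_ord_ge_leq _ dk).
elim: p=> [|p IHp]; first by rewrite subrr.
have -> : (f + d) ^+ p.+1 - f ^+ p.+1 = d * (f + d) ^+ p + f * ((f + d) ^+ p - f ^+ p).
  by rewrite !exprS; ring.
apply: fps_ord_geD; last exact: (fps_ord_geM _ f1 IHp).
by apply: (fps_ord_geM _ dk (fps_ord_geX (n := p) fd1)); lia.
Qed.

(** The derivative is taken at [v], the leading part of [f], and not at [f]: since [f - v] has order
    2, the error made is of the same order as the one allowed for the terms quadratic in [d]. *)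
Lemma fps_ord_ge_exprB_linear v f d k p :
  fps_ord_ge 1 v -> fps_ord_ge 2 (f - v) -> fps_ord_ge k.+2 d ->
  fps_ord_ge (p + k.+2) ((f + d) ^+ p - f ^+ p - d * v ^+ p.-1 *+ p).
Proof.
move=> v1 fv dk.
have f1 : fps_ord_ge 1 f.
  by rewrite -(subrK v f); apply: fps_ord_geD v1; apply: fps_ord_ge_leq fv.
elim: p=> [|p IHp]; first by rewrite !expr0 mulr0n !subrr.
have -> : (f + d) ^+ p.+1 - f ^+ p.+1 - d * v ^+ p *+ p.+1 =
   d * ((v + (f - v + d)) ^+ p - v ^+ p) + (f - v) * ((f + d) ^+ p - f ^+ p)
   + v * ((f + d) ^+ p - f ^+ p - d * v ^+ p.-1 *+ p).
  rewrite [v + _]addrA [v + (f - v)]addrC subrK !exprS.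
  case: (p) => [|q]; rewrite /= ?mulr0n ?expr0; first by ring.
  by rewrite !exprS !mulrS; ring.
have fvd2 : fps_ord_ge 2 (f - v + d).
  by apply: fps_ord_geD=> //; apply: fps_ord_ge_leq dk.
apply: fps_ord_geD; last by apply: (fps_ord_geM _ v1 IHp); lia.
apply: fps_ord_geD.
  by apply: (fps_ord_geM _ dk (fps_ord_ge_exprB (p := p) v1 fvd2)); lia.
by apply: (fps_ord_geM _ fv (fps_ord_ge_exprB (p := p) f1 dk)); lia.
Qed.

Lemma fps_monomE (c : K) p q :
  fps_monom c p q = fps_monom c 0 0 * fps_var K ord0 ^+ p * fps_var K ord_max ^+ q.
Proof.
elim: p=> [|p IHp]; last first.
  have -> : fps_monom c p.+1 q = fps_var K ord0 * fps_monom c p q.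
    apply/funext=> -[|a]; apply/funext=> b; rewrite -fps_mulE fps_monom_mul// mul1r.
    by rewrite /= subn1 subn0.
  by rewrite IHp exprS; ring.
elim: q=> [|q IHq]; first by rewrite !expr0 !mulr1.
have -> : fps_monom c 0 q.+1 = fps_var K ord_max * fps_monom c 0 q.
  apply/funext=> a; apply/funext=> -[|b]; rewrite -fps_mulE fps_monom_mul ?mul1r//.
    by rewrite /fps_monom andbF.
  by rewrite /= subn1 subn0.
by rewrite IHq exprS; ring.
Qed.

Lemma fps_deriv0_monom (c : K) p q :
  fps_deriv ord0 (fps_monom c p q) = fps_monom (c *+ p) p.-1 q.
Proof.
apply/funext=> a; apply/funext=> b; rewrite /fps_deriv /fps_monom /=.
case: p=> [|p]; rewrite /= ?mul0rn ?mulr0n ?if_same// eqSS.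
by case: ifP=> [/andP[/eqP-> _]|]; rewrite ?mul0rn.
Qed.

Lemma fps_deriv1_monom (c : K) p q :
  fps_deriv ord_max (fps_monom c p q) = fps_monom (c *+ q) p q.-1.
Proof.
apply/funext=> a; apply/funext=> b; rewrite /fps_deriv /fps_monom /=.
case: q=> [|q]; rewrite /= ?andbF ?mul0rn ?mulr0n ?if_same// eqSS.
by case: ifP=> [/andP[_ /eqP->]|]; rewrite ?mul0rn.
Qed.

Lemma vf_apply_monom D (c : K) p q :
  vf_apply D (fps_monom c p q) = fps_monom c 0 0 *
    (D ord0 * fps_var K ord0 ^+ p.-1 *+ p * fps_var K ord_max ^+ q +
     fps_var K ord0 ^+ p * (D ord_max * fps_var K ord_max ^+ q.-1 *+ q)).
Proof.
have cMn n : fps_monom (c *+ n) 0 0 = fps_monom c 0 0 *+ n.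
  elim: n=> [|n IHn]; apply/funext=> a; apply/funext=> b.
    by rewrite /fps_monom !mulr0n if_same.
  by rewrite !mulrS -IHn fpsD /fps_monom; case: ifP; rewrite ?addr0.
rewrite /vf_apply fps_deriv0_monom fps_deriv1_monom !fps_mulE fps_addE fps_monomE
    [fps_monom (c *+ q) _ _]fps_monomE !cMn.
ring.
Qed.

(** Taking the derivative at the identity instead of at [phi] makes the linear term equal to
    [vf_apply D] of the monomial, one of the two halves of the bracket with H. *)
Lemma fps_ord_ge_monom_linear D (phi : vfps2 K) k (c : K) p q :
  (forall e, fps_ord_ge 2 (phi e - fps_var K e)) -> (forall e, fps_ord_ge k.+2 (D e)) ->
  fps_ord_ge (p + q + k.+2)
    (fps_monom c 0 0 * (phi ord0 + D ord0) ^+ p * (phi ord_max + D ord_max) ^+ q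
     - fps_monom c 0 0 * phi ord0 ^+ p * phi ord_max ^+ q
     - vf_apply D (fps_monom c p q)).
Proof.
move=> phi2 Dk; rewrite vf_apply_monom.
have v1 := fps_ord_ge_var.
have phi1 e : fps_ord_ge 1 (phi e).
  rewrite -(subrK (fps_var K e) (phi e)); apply: fps_ord_geD (v1 _).
  exact: fps_ord_ge_leq (phi2 e).
have P := fps_ord_ge_exprB_linear (p := p) (v1 ord0) (phi2 ord0) (Dk ord0).
have R := fps_ord_ge_exprB_linear (p := q) (v1 ord_max) (phi2 ord_max) (Dk ord_max).
have R1 := fps_ord_ge_exprB (p := q) (phi1 ord_max) (Dk ord_max).
have P2 := fps_ord_ge_exprB (p := p) (v1 ord0) (phi2 ord0).
have R2 : fps_ord_ge (q + 1) ((phi ord_max + D ord_max) ^+ q - fps_var K ord_max ^+ q).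
  have -> : phi ord_max + D ord_max =
      fps_var K ord_max + (phi ord_max - fps_var K ord_max + D ord_max) by ring.
  apply: fps_ord_ge_exprB=> //; apply: fps_ord_geD=> //.
  exact: fps_ord_ge_leq (Dk _).
have PL : fps_ord_ge (p + k.+1) (D ord0 * fps_var K ord0 ^+ p.-1 *+ p).
  case: (p) => [|r]; first by rewrite mulr0n.
  by apply/fps_ord_geMn/(fps_ord_geM _ (Dk _) (fps_ord_geX (n := r) (v1 _))); lia.
move: (phi ord0) (phi ord_max) (D ord0) (D ord_max) (fps_var K ord0)
  (fps_var K ord_max) (v1 ord0) (phi1 ord_max) (Dk ord_max) P R R1 P2 R2 PL =>
  f g d e v w v1_0 g1 e1 P R R1 P2 R2 PL.
have {}P2 : fps_ord_ge (p + 1) (f ^+ p - v ^+ p) by move: P2; rewrite [v + _]addrC subrK.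
set LP := (d * _ *+ p); set LR := (e * _ *+ q).
pose DP := (f + d) ^+ p - f ^+ p - LP; pose DR := (g + e) ^+ q - g ^+ q - LR.
rewrite -/LP -/DP in P; rewrite -/LR -/DR in R; rewrite -/LP in PL.
(* Product rule with its remainders: each of the four products on the right has order at least
   [p + q + k.+2]. *)
have -> : fps_monom c 0 0 * (f + d) ^+ p * (g + e) ^+ q - fps_monom c 0 0 * f ^+ p
     * g ^+ q - fps_monom c 0 0 * (LP * w ^+ q + v ^+ p * LR) =
   fps_monom c 0 0 * (DP * (g + e) ^+ q + LP * ((g + e) ^+ q - w ^+ q) +
     (f ^+ p - v ^+ p) * ((g + e) ^+ q - g ^+ q) + v ^+ p * DR).
  by rewrite /DP /DR; ring.
apply: (fps_ord_geM _ (@fps_ord_ge_monom c 0 0)); first exact: leqnn.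
apply: fps_ord_geD; first (apply: fps_ord_geD; first apply: fps_ord_geD).
- have ge1 : fps_ord_ge 1 (g + e) by apply/fps_ord_geD/(fps_ord_ge_leq _ e1).
  by apply: (fps_ord_geM _ P (fps_ord_geX (n := q) ge1)); lia.
- by apply: (fps_ord_geM _ PL R2); lia.
- by apply: (fps_ord_geM _ P2 R1); lia.
- by apply: (fps_ord_geM _ (fps_ord_geX (n := p) v1_0) R); lia.
Qed.
End FpsOrder.

(** * Existence of the normalizing transformation *)

Section NormalFormExistence.
Variable K : fieldType.
Implicit Types (f g : fps2 K) (phi D F G H N P Q X Y W : vfps2 K).

Lemma ord_geP k F : ord_ge k F <-> forall c, fps_ord_ge k.+1 (F c).
Proof.
split=> [Fk c a b ab|Fk c a b].
  by apply/eqP; apply: contraTT ab; rewrite -leqNgt => /Fk.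
by apply: contraNT; rewrite -ltnNge => /Fk->.
Qed.

Lemma vfps_addE F G c : vfps_add F G c = F c + G c. Proof. by []. Qed.

Lemma fps_substD f g phi : fps_subst (f + g) phi = fps_subst f phi + fps_subst g phi.
Proof.
apply/funext=> a; apply/funext=> b; rewrite fpsD /fps_subst -big_split.
apply: eq_bigr=> p _; rewrite -big_split; apply: eq_bigr=> q _.
by rewrite /= fpsD mulrDl.
Qed.

Lemma fps_ord_ge_term (u v : fps2 K) p q : fps_ord_ge 1 u -> fps_ord_ge 1 v ->
  fps_ord_ge (p + q) (u ^+ p * v ^+ q).
Proof.
move=> u1 v1.
by apply: (fps_ord_geM _ (fps_ord_geX (n := p) u1) (fps_ord_geX (n := q) v1)).
Qed.

Lemma fps_subst_monom (c : K) p q phi : (forall e, fps_ord_ge 1 (phi e)) ->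
  fps_subst (fps_monom c p q) phi = fps_monom c 0 0 * phi ord0 ^+ p * phi ord_max ^+ q.
Proof.
move=> phi1; apply/funext=> a; apply/funext=> b.
rewrite -mulrA -fps_mulE fps_monom_mul !subn0 /=.
have T := fps_ord_ge_term (p := p) (q := q) (phi1 ord0) (phi1 ord_max).
(* The finite sum may miss the index [(p, q)] only if [p + q] exceeds [a + b], and then the product
   has no coefficient in that degree. *)
have [pq|pq] := ltnP (a + b) (p + q).
  rewrite T// mulr0 /fps_subst big1// => i _; rewrite big1// => j _.
  rewrite /fps_monom; case: ifP=> [/andP[/eqP ip /eqP jq]|_]; last by rewrite mul0r.
  by rewrite !fps_expE fps_mulE ip jq T// mulr0.
have pab : (p < (a + b).+1)%N by lia.
have qab : (q < (a + b).+1)%N by lia.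
rewrite /fps_subst (bigD1 (Ordinal pab))//= (bigD1 (Ordinal qab))//=.
rewrite {1}/fps_monom !eqxx /= !fps_expE fps_mulE !big1 ?addr0// => i.
  rewrite -(inj_eq val_inj)/= => ip; rewrite big1// => j _.
  by rewrite /fps_monom (negbTE ip) mul0r.
by rewrite -(inj_eq val_inj)/= => ip; rewrite /fps_monom (negbTE ip) andbF mul0r.
Qed.

Lemma fps_ord_ge_subst n f phi : (forall e, fps_ord_ge 1 (phi e)) ->
  fps_ord_ge n f -> fps_ord_ge n (fps_subst f phi).
Proof.
move=> phi1 fn a b ab; rewrite /fps_subst big1// => p _; rewrite big1// => q _.
have [pq|pq] := ltnP (p + q) n; first by rewrite fn// mul0r.
by rewrite !fps_expE fps_mulE fps_ord_ge_term ?mulr0//; lia.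
Qed.

Lemma fps_ord_ge_substB n k f phi D :
  (forall e, fps_ord_ge 1 (phi e)) -> (forall e, fps_ord_ge k.+1 (D e)) ->
  fps_ord_ge n f -> fps_ord_ge (n + k) (fps_subst f (vfps_add phi D) - fps_subst f phi).
Proof.
move=> phi1 Dk fn a b ab; rewrite fpsD fpsN /fps_subst -sumrB big1// => p _.
rewrite -sumrB big1// => q _; rewrite -mulrBr.
have [pq|pq] := ltnP (p + q) n; first by rewrite fn// mul0r.
rewrite !fps_expE !fps_mulE -fpsN -fpsD !vfps_addE.
set u := phi ord0; set v := phi ord_max; set d := D ord0; set e := D ord_max.
have -> : (u + d) ^+ p * (v + e) ^+ q - u ^+ p * v ^+ q =
  ((u + d) ^+ p - u ^+ p) * (v + e) ^+ q + u ^+ p * ((v + e) ^+ q - v ^+ q) by ring.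
have ve1 : fps_ord_ge 1 (v + e).
  by apply: fps_ord_geD; [exact: phi1|apply: fps_ord_ge_leq (Dk _)].
have U := fps_ord_ge_exprB (p := p) (phi1 ord0) (Dk ord0).
have V := fps_ord_ge_exprB (p := q) (phi1 ord_max) (Dk ord_max).
suff : fps_ord_ge (p + q + k)
    (((u + d) ^+ p - u ^+ p) * (v + e) ^+ q + u ^+ p * ((v + e) ^+ q - v ^+ q)).
  by move=> T; rewrite T ?mulr0//; lia.
apply: fps_ord_geD; first by apply: (fps_ord_geM _ U (fps_ord_geX (n := q) ve1)); lia.
by apply: (fps_ord_geM _ (fps_ord_geX (n := p) (phi1 _)) V); lia.
Qed.

Lemma fps_derivD e f g : fps_deriv e (f + g) = fps_deriv e f + fps_deriv e g.
Proof.
apply/funext=> a; apply/funext=> b; rewrite fpsD /fps_deriv.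
by case: ifP=> _; rewrite mulrnDl.
Qed.

Lemma vf_applyE P f :
  vf_apply P f = P ord0 * fps_deriv ord0 f + P ord_max * fps_deriv ord_max f.
Proof. by []. Qed.

Lemma vf_applyD P f g : vf_apply P (f + g) = vf_apply P f + vf_apply P g.
Proof. by rewrite !vf_applyE !fps_derivD; ring. Qed.

Lemma vf_applyDl P Q f : vf_apply (vfps_add P Q) f = vf_apply P f + vf_apply Q f.
Proof. by rewrite !vf_applyE !vfps_addE; ring. Qed.

Lemma vf_apply_var P c : vf_apply P (fps_var K c) = P c.
Proof.
have D0 : fps_deriv ord0 (fps_monom (1 : K) 1 0) = 1.
  apply/funext=> a; apply/funext=> b.
  rewrite /fps_deriv /= /fps_monom eqSS -[RHS]/(fps_monom 1 0 0 a b) /fps_monom.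
  by case: a=> [|a]; case: b=> //= *; rewrite mul0rn.
have D1 : fps_deriv ord_max (fps_monom (1 : K) 0 1) = 1.
  apply/funext=> a; apply/funext=> b.
  rewrite /fps_deriv /= /fps_monom eqSS -[RHS]/(fps_monom 1 0 0 a b) /fps_monom.
  by case: b=> [|b]; case: a=> //= *; rewrite mul0rn.
have D2 : fps_deriv ord0 (fps_monom (1 : K) 0 1) = 0.
  by apply/funext=> a; apply/funext=> b; rewrite /fps_deriv /= /fps_monom mul0rn.
have D3 : fps_deriv ord_max (fps_monom (1 : K) 1 0) = 0.
  by apply/funext=> a; apply/funext=> b; rewrite /fps_deriv /= /fps_monom andbF mul0rn.
rewrite vf_applyE /fps_var; case: eqP=> [->|c0]; first by rewrite D0 D3 mulr1 mulr0 addr0.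
have -> : c = ord_max by case: c c0 => -[|[|//]] ? // ne0; [case: ne0|]; apply: val_inj.
by rewrite D1 D2 mulr1 mulr0 add0r.
Qed.

Lemma fps_ord_ge_vf_apply n i j P f : (n <= i + j)%N ->
  (forall e, fps_ord_ge i (P e)) -> fps_ord_ge j.+1 f -> fps_ord_ge n (vf_apply P f).
Proof.
move=> nij Pi fj; rewrite vf_applyE.
by apply: fps_ord_geD; apply: (fps_ord_geM nij (Pi _)); apply: fps_ord_ge_deriv.
Qed.

Lemma vf_bracketE P Q c : vf_bracket P Q c = vf_apply P (Q c) - vf_apply Q (P c).
Proof. by []. Qed.

(* Vanishes exactly when [x = y + Q(y)] takes [x' = F(x)] to [y' = G(y)]. *)
Definition residual F Q G : vfps2 K := fun c =>
  fps_subst (F c) (near_identity Q) - vf_apply G (near_identity Q c).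

Variables (H : vfps2 K) (chi : nat) (h : 'I_2 -> K) (p q : 'I_2 -> nat).
Hypothesis H_monom : forall c, H c = fps_monom (h c) (p c) (q c).
Hypothesis H_degree : forall c, (p c + q c)%N = chi.+1.

Let H_ord c : fps_ord_ge chi.+1 (H c).
Proof. by rewrite H_monom -(H_degree c); apply: fps_ord_ge_monom. Qed.

Lemma fps_ord_ge_bracket k D : (forall c, fps_ord_ge k.+1 (D c)) ->
  forall c, fps_ord_ge (k + chi.+1) (vf_bracket H D c).
Proof.
move=> Dk c; rewrite vf_bracketE; apply: fps_ord_geB.
  by apply: (fps_ord_ge_vf_apply _ H_ord (Dk c)); lia.
by apply: (fps_ord_ge_vf_apply _ Dk (H_ord c)); lia.
Qed.

(** Moving [phi] by [D] changes H(phi) by D(H) and the derivative of [phi] along H by H(D), which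
    together give -[H, D]; [N] acts on the leading part of [phi], the identity, and gives -N. All
    other terms pair [D] or [N] with X, Y, Q or the correction itself and gain one degree. *)
Lemma residual_perturb k X Q Y D N :
  (forall c, fps_ord_ge chi.+2 (X c)) -> (forall c, fps_ord_ge 2 (Q c)) ->
  (forall c, fps_ord_ge chi.+2 (Y c)) -> (forall c, fps_ord_ge k.+2 (D c)) ->
  (forall c, fps_ord_ge (k + chi.+2) (N c)) ->
  forall c, fps_ord_ge (k + chi.+3)
    (residual (vfps_add H X) (vfps_add Q D) (vfps_add H (vfps_add Y N)) c
     - residual (vfps_add H X) Q (vfps_add H Y) c + (vf_bracket H D c + N c)).
Proof.
move=> Xo Qo Yo Do No c.
pose phi := near_identity Q.
have phiD : near_identity (vfps_add Q D) = vfps_add phi D.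
  by apply/funext=> e; rewrite /near_identity /vfps_add /phi /near_identity !fps_addE;
      ring.
have phi2 e : fps_ord_ge 2 (phi e - fps_var K e).
  have -> : phi e - fps_var K e = Q e by rewrite /phi /near_identity fps_addE; ring.
  exact: Qo.
have phi1 e : fps_ord_ge 1 (phi e).
  by apply: fps_ord_geD; [exact: fps_ord_ge_var|apply: fps_ord_ge_leq (Qo e)].
have phiD1 e : fps_ord_ge 1 (vfps_add phi D e).
  by apply: fps_ord_geD=> //; apply: fps_ord_ge_leq (Do e).
have E1 := fps_ord_ge_monom_linear (h c) (p := p c) (q := q c) phi2 Do.
rewrite -!vfps_addE -(fps_subst_monom _ _ _ phi1) -(fps_subst_monom _ _ _ phiD1)
    -H_monom in E1.
have E2 := fps_ord_ge_substB phi1 Do (Xo c).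
have E3 := fps_ord_ge_vf_apply (n := k + chi.+3) _ Yo (Do c).
have QDo : fps_ord_ge 2 (Q c + D c).
  by apply: fps_ord_geD=> //; apply: fps_ord_ge_leq (Do c).
have E4 := fps_ord_ge_vf_apply (n := k + chi.+3) _ No QDo.
rewrite /residual phiD -/phi vf_bracketE.
rewrite !vfps_addE !fps_substD !vf_applyDl !vf_applyD.
set TH := (X in fps_ord_ge _ X) in E1; set TX := (X in fps_ord_ge _ X) in E2.
rewrite (_ : _ + _ = TH + TX - vf_apply Y (D c) - vf_apply N (Q c + D c)); last first.
  by rewrite /TH /TX !vf_applyD !vf_apply_var; ring.
apply: fps_ord_geB; last by apply: E4; lia.
apply: fps_ord_geB; last by apply: E3; lia.
apply: fps_ord_geD; last by apply: fps_ord_ge_leq E2; lia.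
by apply: fps_ord_ge_leq E1; rewrite H_degree; lia.
Qed.
(** As [j] is positive, the steps from stage [a + b] on no longer touch the coefficient at [(a, b)],
    so the diagonal series is the limit. *)
Lemma fps_ord_ge_limit (u : nat -> fps2 K) (f : fps2 K) j : (0 < j)%N ->
  (forall n, fps_ord_ge (n + j) (u n.+1 - u n)) ->
  (forall a b, f a b = u (a + b)%N a b) ->
  forall n, fps_ord_ge (n + j) (f - u n).
Proof.
move=> j0 uS fE; have uD n i : fps_ord_ge (n + j) (u (n + i)%N - u n).
  elim: i=> [|i IHi]; first by rewrite addn0 subrr.
  rewrite addnS -[u _ - _](subrKA (u (n + i)%N)); apply: fps_ord_geD=> //.
  by apply: fps_ord_ge_leq (uS _); lia.
move=> n a b ab; rewrite fpsD fpsN fE.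
have [nab|abn] := leqP n (a + b).
  by rewrite -[(a + b)%N](subnKC nab) -fpsN -fpsD uD.
apply/eqP; rewrite -oppr_eq0 opprB -fpsN -fpsD -[n in u n](subnKC (ltnW abn)) uD//; lia.
Qed.

(* Adding D of degree k + 2 to Q and N of degree k + chi + 2 to Y changes the
   residual by -([H, D] + N) in degree k + chi + 2 and not at all in lower
   degrees, so Q and Y can be found degree by degree. *)
Theorem normal_form_exists (S : 'I_2 -> nat -> nat -> Prop) :
  (forall k W, exists D,
     (forall c a b, (a + b)%N <> k.+2 -> D c a b = 0) /\
     (forall c a b, (a + b)%N = (k + chi.+2)%N -> ~ S c a b ->
        vf_bracket H D c a b = W c a b)) ->
  forall X, ord_ge chi.+1 X ->
    exists Q Y,
      [/\ ord_ge 1 Q, transforms_into (vfps_add H X) Q (vfps_add H Y),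
          ord_ge chi.+1 Y & forall c a b, ~ S c a b -> Y c a b = 0].
Proof.
move=> H_solvable X /ord_geP Xo.
have /choice [solve solveP] : forall kW : nat * vfps2 K, exists D,
     (forall c a b, (a + b)%N <> kW.1.+2 -> D c a b = 0) /\
     (forall c a b, (a + b)%N = (kW.1 + chi.+2)%N -> ~ S c a b ->
        vf_bracket H D c a b = kW.2 c a b).
  by case=> k W; exact: H_solvable.
pose W (st : vfps2 K * vfps2 K) := residual (vfps_add H X) st.1 (vfps_add H st.2).
pose D n st := solve (n, W st).
(* Restricted to the single degree [n + chi.+2], where it is the part of the residual that the
   bracket does not cancel; by the choice of [D] that part lives on [S]. *)
pose N n st : vfps2 K := fun c a b =>
  if (a + b == n + chi.+2)%N then W st c a b - vf_bracket H (D n st) c a b else 0.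
pose fix st n : vfps2 K * vfps2 K :=
  if n is n'.+1 then (vfps_add (st n').1 (D n' (st n')),
      vfps_add (st n').2 (N n' (st n')))
  else (fun _ => 0, fun _ => 0).
have Do n s c : fps_ord_ge n.+2 (D n s c).
  by move=> a b ab; apply: (solveP (n, W s)).1 => /=; lia.
have No n s c : fps_ord_ge (n + chi.+2) (N n s c).
  by move=> a b ab; rewrite /N; case: eqP=> // ?; lia.
have NS n s c a b : ~ S c a b -> N n s c a b = 0.
  move=> nS; rewrite /N; case: eqP=> // ab.
  by rewrite (solveP (n, W s)).2// subrr.
have Qo n c : fps_ord_ge 2 ((st n).1 c).
  elim: n=> // n IHn; apply: fps_ord_geD=> //; exact: fps_ord_ge_leq (Do _ _ _).
have Yo n c : fps_ord_ge chi.+2 ((st n).2 c).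
  by elim: n=> // n IHn; apply: fps_ord_geD=> //; apply: fps_ord_ge_leq (No _ _ _); lia.
have YS n c a b : ~ S c a b -> (st n).2 c a b = 0.
  by move=> nS; elim: n=> // n IHn; rewrite /= vfps_addE fpsD IHn NS// addr0.
have Wo n c : fps_ord_ge (n + chi.+2) (W (st n) c).
  elim: n=> [|n IHn]; last first.
    move=> a b ab; have := @residual_perturb n _ _ _ _ _ Xo (Qo n) (Yo n) (Do n (st n))
        (No n (st n)) c a b.
    rewrite -[(n + chi.+3)%N]addSnnS => /(_ ab).
    have [ab'|ab'] := ltnP (a + b) (n + chi.+2).
      rewrite !(fpsD, fpsN) -/(W (st n)) (IHn a b ab') (No _ _ _ _ _ ab').
      by rewrite (fps_ord_ge_bracket (Do n (st n)))// ?addr0 ?subr0//; lia.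
    rewrite !(fpsD, fpsN) {2}/N ifT; last by lia.
    by rewrite [X in _ + X]addrC subrK subrK.
  rewrite /W /residual /= !vfps_addE fps_substD.
  have idE : near_identity (fun _ => 0) = fps_var K.
    by apply/funext=> e; rewrite /near_identity fps_addE addr0.
  rewrite idE H_monom fps_subst_monom; last exact: fps_ord_ge_var.
  rewrite -fps_monomE -H_monom vf_apply_var vfps_addE addr0 [X in X - _]addrC addrK.
  by apply: fps_ord_ge_subst (Xo c); exact: fps_ord_ge_var.
pose Q : vfps2 K := fun c a b => (st (a + b)%N).1 c a b.
pose Y : vfps2 K := fun c a b => (st (a + b)%N).2 c a b.
have Qlim n c : fps_ord_ge n.+2 (Q c - (st n).1 c).
  rewrite -addn2; apply: (@fps_ord_ge_limit (fun n => (st n).1 c))=> // i.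
  by rewrite /= vfps_addE addrC addKr addn2.
have Ylim n c : fps_ord_ge (n + chi.+2) (Y c - (st n).2 c).
  apply: (@fps_ord_ge_limit (fun n => (st n).2 c))=> // i.
  by rewrite /= vfps_addE addrC addKr.
exists Q, Y; split.
- by apply/ord_geP=> c a b ab; apply: Qo.
- move=> c a b; apply/esym/eqP; rewrite -subr_eq0 -fpsN -fpsD; apply/eqP.
  (* The passage from stage [n] to the limit is one perturbation of the orders required by
     [residual_perturb], which therefore also controls the residual of the limit up to degree
     [n]. *)
  pose n := (a + b)%N.
  have := @residual_perturb n _ _ _ _ _ Xo (Qo n) (Yo n) (Qlim n) (Ylim n) c.
  have -> : vfps_add (st n).1 (fun c => Q c - (st n).1 c) = Q.
    by apply/funext=> e; rewrite vfps_addE addrC subrK.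
  have -> : vfps_add (st n).2 (fun c => Y c - (st n).2 c) = Y.
    by apply/funext=> e; rewrite vfps_addE addrC subrK.
  move=> /(_ a b); rewrite !(fpsD, fpsN) -/(W (st n)) (Wo n c a b); last by lia.
  have YE : Y c a b - (st n).2 c a b = 0 by apply: (Ylim n c a b); lia.
  rewrite YE (fps_ord_ge_bracket (Qlim n)); last by lia.
  by rewrite subr0 !addr0; apply; lia.
- by apply/ord_geP=> c a b ab; apply: Yo.
- by move=> c a b nS; apply: YS.
Qed.
End NormalFormExistence.

(** * Resonant sets as complements of the image of ad_H *)

Section ResonantSet.
Variables (K : fieldType) (H : vfps2 K) (chi : nat) (S : 'I_2 -> nat -> nat -> Prop).
Implicit Types (D W : vfps2 K).

Lemma vpoly_of_vfpsK k D : (forall c a b, (a + b)%N <> k.+1 -> D c a b = 0) ->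
  vfps_of_vpoly (vpoly_of_vfps k D) = D.
Proof.
move=> Dk; apply/funext=> c; apply/funext=> a; apply/funext=> b.
rewrite /vfps_of_vpoly; case: eqP=> [ab|/Dk->//].
by rewrite mxE inordK ?ltnS -?ab ?leq_addr ?addKn.
Qed.

Lemma vfps_of_vpolyE k (P : vpoly K k) c (p : 'I_k.+2) :
  vfps_of_vpoly P c p (k.+1 - p)%N = P c p.
Proof. by rewrite /vfps_of_vpoly subnKC ?eqxx ?inord_val//; rewrite -ltnS. Qed.

Lemma vfps_of_vpoly_degree k (P : vpoly K k) c a b :
  (a + b)%N <> k.+1 -> vfps_of_vpoly P c a b = 0.
Proof. by rewrite /vfps_of_vpoly; case: eqP. Qed.

Section Degree.
Variable k : nat.
(** The two hypotheses say, in degree [k], that the monomials at the positions in [S] together with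
    the image of ad_H span the space, and that their span meets the image only in 0. *)
Hypothesis H_solvable : forall W, exists D,
  (forall c a b, (a + b)%N <> k.+1 -> D c a b = 0) /\
  (forall c a b, (a + b)%N = (k + chi).+1 -> ~ S c a b ->
     vf_bracket H D c a b = W c a b).
Hypothesis H_disjoint : forall D,
  (forall c a b, (a + b)%N <> k.+1 -> D c a b = 0) ->
  (forall c a b, (a + b)%N = (k + chi).+1 -> ~ S c a b ->
     vf_bracket H D c a b = 0) ->
  forall c a b, (a + b)%N = (k + chi).+1 -> vf_bracket H D c a b = 0.

Let pos := ('I_2 * 'I_(k + chi).+2)%type.
Let A : {set pos} := [set x : pos | `[< S x.1 x.2 ((k + chi).+1 - x.2)%N >]].
Let V := vpoly K (k + chi).
Let image : {vspace V} := limg (linfun (@homological K H chi k)).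
Let unit_at (x : pos) : V := delta_mx x.1 x.2.
Let units : #|A|.-tuple V := [tuple unit_at (enum_val i) | i < #|A|].
Let T : {vspace V} := <<units>>%VS.

Let AP (x : pos) : reflect (S x.1 x.2 ((k + chi).+1 - x.2)%N) (x \in A).
Proof. by rewrite inE; exact: asboolP. Qed.

Let unit_atE (x y : pos) : unit_at x y.1 y.2 = (y == x)%:R.
Proof. by rewrite mxE -xpair_eqE -!surjective_pairing. Qed.

Let units_free : free units.
Proof.
apply/freeP=> z z0 j; move/matrixP/(_ (enum_val j).1 (enum_val j).2): z0.
rewrite summxE mxE (bigD1 j)//= big1 ?addr0.
  by rewrite mxE (nth_map j) ?size_enum_ord// nth_ord_enum unit_atE eqxx mulr1.
move=> i ij; rewrite mxE (nth_map i) ?size_enum_ord// nth_ord_enum unit_atE.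
by rewrite (inj_eq enum_val_inj) eq_sym (negbTE ij) mulr0.
Qed.

Let vpoly_sum (X : V) : X = \sum_(x : pos) X x.1 x.2 *: unit_at x.
Proof. by rewrite [LHS]matrix_sum_delta pair_bigA. Qed.

Let mem_T (X : V) : (X \in T) <-> (forall x : pos, x \notin A -> X x.1 x.2 = 0).
Proof.
split=> [XT x xA|XA].
  rewrite (coord_span XT) summxE big1// => i _.
  rewrite mxE (nth_map i) ?size_enum_ord// nth_ord_enum unit_atE.
  by case: eqP=> [xE|]; rewrite ?mulr0//; move: xA; rewrite xE enum_valP.
rewrite [X]vpoly_sum; apply: rpred_sum=> x _.
have [xA|/XA->] := boolP (x \in A); last by rewrite scale0r mem0v.
apply/memvZ/memv_span/mapP; exists (enum_rank_in xA x); rewrite ?mem_enum//.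
by rewrite enum_rankK_in.
Qed.

Let homologicalE (Q : vpoly K k) (x : pos) : homological H chi Q x.1 x.2 =
  vf_bracket H (vfps_of_vpoly Q) x.1 x.2 ((k + chi).+1 - x.2)%N.
Proof. by rewrite mxE. Qed.

Let pos_degree (x : pos) : (x.2 + ((k + chi).+1 - x.2))%N = (k + chi).+1.
Proof. by rewrite subnKC// -ltnS. Qed.

Let T_image_full : (T + image)%VS = fullv.
Proof.
apply/eqP; rewrite eqEsubv subvf /=; apply/subvP=> X _.
have [D [Dk DX]] := H_solvable (vfps_of_vpoly X).
pose Y := homological H chi (vpoly_of_vfps k D).
have Yim : Y \in image by rewrite -[Y]lfunE memv_img ?memvf.
rewrite -[X](subrK Y) memv_add//; apply/mem_T=> x /AP xS.
by rewrite !mxE vpoly_of_vfpsK// DX ?pos_degree// vfps_of_vpolyE subrr.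
Qed.

Let T_image_disjoint : (T :&: image = 0)%VS.
Proof.
apply/eqP; rewrite -subv0; apply/subvP=> X; rewrite memv_cap => /andP[/mem_T XT].
case/memv_imgP=> Q _; rewrite lfunE /= => XE.
rewrite memv0; apply/eqP/matrixP=> c p; rewrite [RHS]mxE XE.
rewrite -[c]/(c, p).1 -[p in LHS]/(c, p).2 homologicalE.
apply: H_disjoint=> //; first exact: vfps_of_vpoly_degree.
move=> {}c a b ab nS; have ak : (a < (k + chi).+2)%N by lia.
have bE : b = ((k + chi).+1 - a)%N by lia.
have := XT (c, Ordinal ak); rewrite XE homologicalE /= -bE; apply.
by apply/AP; rewrite /= -bE.
Qed.

Let count_eq : resonance_count H chi k = #|A|.
Proof.
rewrite /resonance_count -T_image_full dimv_disjoint_sum// addnK.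
by move/eqP: units_free; rewrite size_tuple.
Qed.

Let proj := daddv_pi T image.

Let proj_image X : X \in image -> proj X = 0.
Proof.
move=> Xim; have := daddv_pi_add T_image_disjoint (subvP (addvSr T image) _ Xim).
rewrite [X in _ + X](daddv_pi_id _ Xim); last by rewrite capvC T_image_disjoint.
by move=> /eqP; rewrite -[eqbRHS]add0r => /eqP/addIr.
Qed.

(* The resonance equations are the coordinates of the projection onto the span
   of the monomials at the positions in S, along the image of ad_H: on these
   positions they form an identity matrix. *)
Lemma resonant_positions :
  exists (a : (resonance_count H chi k).-tuple (vpoly K (k + chi)))
         (l : 'I_(resonance_count H chi k) -> 'I_2 * 'I_(k + chi).+2),
    [/\ resonance_basis a,
        (forall (c : 'I_2) (p : 'I_(k + chi).+2),
           S c p ((k + chi).+1 - p)%N <-> exists j, l j = (c, p)) &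
        \det (\matrix_(i, j) tnth a i (l j).1 (l j).2) != 0].
Proof.
pose l (j : 'I_(resonance_count H chi k)) : pos := enum_val (cast_ord count_eq j).
have l_inj : injective l by move=> i j /enum_val_inj/cast_ord_inj.
(* With these coefficients, pairing [eqn i] with a vector yields the entry at [l i] of its
   projection, which is 0 on the image. *)
pose eqn i : V := \matrix_(c, p) proj (delta_mx c p) (l i).1 (l i).2.
have eqn_l i j : eqn i (l j).1 (l j).2 = (j == i)%:R.
  rewrite mxE daddv_pi_id//; last first.
    by apply/mem_T=> x xA; rewrite unit_atE; case: eqP=> // xE; move: xA;
        rewrite xE enum_valP.
  by rewrite unit_atE (inj_eq l_inj) eq_sym.
exists [tuple eqn i | i < _], l; split.
- split.
    apply/freeP=> z z0 j; move/matrixP/(_ (l j).1 (l j).2): z0.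
    rewrite summxE mxE (bigD1 j)//= big1 ?addr0.
      by rewrite mxE (nth_map j) ?size_enum_ord// nth_ord_enum eqn_l eqxx mulr1.
    move=> i ij; rewrite mxE (nth_map i) ?size_enum_ord// nth_ord_enum eqn_l.
    by rewrite eq_sym (negbTE ij) mulr0.
  move=> i Q; rewrite tnth_mktuple; set Y := homological H chi Q.
  have Yim : Y \in image by rewrite -[Y]lfunE memv_img ?memvf.
  have /matrixP/(_ (l i).1 (l i).2) := proj_image Yim.
  rewrite [in proj _](vpoly_sum Y) linear_sum summxE [RHS]mxE => projY.
  rewrite -[RHS]projY pair_bigA; apply: eq_bigr=> x _.
  by rewrite linearZ !mxE mulrC.
- move=> c p; split=> [cpS|[j lj]].
    have cpA : (c, p) \in A by apply/AP.
    exists (cast_ord (esym count_eq) (enum_rank_in cpA (c, p))).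
    by rewrite /l cast_ordKV enum_rankK_in.
  by have := enum_valP (cast_ord count_eq j); rewrite -/(l j) lj => /AP.
- rewrite (_ : \matrix_(i, j) _ = 1%:M) ?det1 ?oner_eq0//.
  by apply/matrixP=> i j; rewrite !mxE tnth_mktuple eqn_l eq_sym.
Qed.
End Degree.
End ResonantSet.

(** * The homological operator and its blocks *)

Section BracketCoefficients.
Variables (K : fieldType) (l' m' : nat).
Local Notation l := l'.+1.
Local Notation m := m'.+1.
Implicit Types (D : vfps2 K) (u v : nat).
Local Notation H := (unperturbed K l m).

(** The two source coefficients of a block. The default 0 stands for a monomial with exponent -1, so
    that one formula covers the borders [u = 0] and [v = 0]. *)
Definition first_coef D u v : K := if v is v'.+1 then D ord0 u v' else 0.
Definition second_coef D u v : K := if u is u'.+1 then D ord_max u' v else 0.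

Let bracketE D c a b :
  vf_bracket H D c a b =
    fps_mul (fps_monom (- m%:R) l m') (fps_deriv ord0 (D c)) a b
    + fps_mul (fps_monom l%:R l' m) (fps_deriv ord_max (D c)) a b
    - (fps_mul (fps_deriv ord0 (H c)) (D ord0) a b
       + fps_mul (fps_deriv ord_max (H c)) (D ord_max) a b).
Proof.
rewrite /vf_bracket /vf_apply /fps_sub /fps_add.
by rewrite ![fps_mul (D _) _]fps_mulC.
Qed.

Let bracket0E D a b :
  vf_bracket H D ord0 a b =
    (if (l <= a)%N && (m' <= b)%N then
       - m%:R * (D ord0 (a - l).+1 (b - m')%N *+ (a - l).+1) else 0)
    + (if (l' <= a)%N && (m <= b)%N then
       l%:R * (D ord0 (a - l')%N (b - m).+1 *+ (b - m).+1) else 0)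
    - ((if (l' <= a)%N && (m' <= b)%N then
        (- m%:R *+ l) * D ord0 (a - l')%N (b - m')%N else 0)
       + (if (l <= a)%N && (m'.-1 <= b)%N then
          (- m%:R *+ m') * D ord_max (a - l)%N (b - m'.-1)%N else 0)).
Proof. by rewrite bracketE /unperturbed /= fps_deriv0_monom fps_deriv1_monom
    !fps_monom_mul. Qed.

Let bracket1E D a b :
  vf_bracket H D ord_max a b =
    (if (l <= a)%N && (m' <= b)%N then
       - m%:R * (D ord_max (a - l).+1 (b - m')%N *+ (a - l).+1) else 0)
    + (if (l' <= a)%N && (m <= b)%N then
       l%:R * (D ord_max (a - l')%N (b - m).+1 *+ (b - m).+1) else 0)
    - ((if (l'.-1 <= a)%N && (m <= b)%N then
        (l%:R *+ l') * D ord0 (a - l'.-1)%N (b - m)%N else 0)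
       + (if (l' <= a)%N && (m' <= b)%N then
          (l%:R *+ m) * D ord_max (a - l')%N (b - m')%N else 0)).
Proof. by rewrite bracketE /unperturbed /= fps_deriv0_monom fps_deriv1_monom
    !fps_monom_mul. Qed.

(** The truncated indices [m'.-1] and [l'.-1] are wrong only for [m' = 0] or [l' = 0], where the
    factor produced by differentiation vanishes. *)
Let guard (x : K) n (f : nat -> K) j i : ((0 < n)%N -> i = j) ->
    x *+ n * f i = x *+ n * f j.
Proof. by case: n => [|n]; [rewrite !mulr0n !mul0r|move=> ->]. Qed.

(** First row of the block matrix. Writing [b.+1 = v + m'] excludes V = 0, for which the target
    y_1^U y_2^(V-1) does not exist. *)
Lemma bracket0_coef D u v a b : (a = u + l')%N -> (b.+1 = v + m')%N ->
  vf_bracket H D ord0 a b =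
    ((l * (v + m'))%:R - (m * (u + l'))%:R + (m * l')%:R) * first_coef D u v
    + (m * m')%:R * second_coef D u v.
Proof.
move=> -> bE; rewrite bracket0E.
have {bE} [[v0 bE]|[w [vE ->]]] : (v = 0 /\ m' = b.+1)%N \/ exists w,
    (v = w.+1 /\ b = w + m')%N.
  by case: v bE => [|w] bE; [left|right; exists w]; lia.
  rewrite v0 bE; case: u => [|u]; rewrite /first_coef /second_coef.
    by do 4 (case: ifP => [|/negbT] ?; try (exfalso; lia)); ring.
  do 4 (case: ifP => [|/negbT] ?; try (exfalso; lia)).
  by rewrite addSn subSS addnK subnn; ring.
rewrite {v}vE; case: u => [|u]; case: w => [|w]; rewrite /first_coef /second_coef.
all: do 4 (case: ifP => [|/negbT] ?; try (exfalso; lia)).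
- by rewrite !addnK ?addSn ?subSS ?addnK; ring.
- by rewrite !addnK ?addSn ?subSS ?addnK; ring.
- rewrite (@guard _ m' _ 1); last by lia.
  by rewrite !addnK ?addSn ?subSS ?addnK; ring.
- rewrite (@guard _ m' _ w.+2); last by lia.
  by rewrite !addnK ?addSn ?subSS ?addnK; ring.
Qed.

Lemma bracket1_coef D u v a b : (a.+1 = u + l')%N -> (b = v + m')%N ->
  vf_bracket H D ord_max a b =
    - (l * l')%:R * first_coef D u v
    + ((l * (v + m'))%:R - (m * (u + l'))%:R - (l * m')%:R) * second_coef D u v.
Proof.
move=> aE ->; rewrite bracket1E.
have {aE} [[u0 aE]|[w [uE ->]]] : (u = 0 /\ l' = a.+1)%N \/ exists w,
    (u = w.+1 /\ a = w + l')%N.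
  by case: u aE => [|w] aE; [left|right; exists w]; lia.
  rewrite u0 aE; case: v => [|v]; rewrite /first_coef /second_coef.
    by do 4 (case: ifP => [|/negbT] ?; try (exfalso; lia)); ring.
  do 4 (case: ifP => [|/negbT] ?; try (exfalso; lia)).
  by rewrite addSn subSS addnK subnn; ring.
rewrite {u}uE; case: v => [|v]; case: w => [|w]; rewrite /first_coef /second_coef.
all: do 4 (case: ifP => [|/negbT] ?; try (exfalso; lia)).
- by rewrite !addnK ?addSn ?subSS ?addnK; ring.
- by rewrite !addnK ?addSn ?subSS ?addnK; ring.
- rewrite (@guard _ l' (D ord0 ^~ _) 1); last by lia.
  by rewrite !addnK ?addSn ?subSS ?addnK; ring.
- rewrite (@guard _ l' (D ord0 ^~ _) w.+2); last by lia.
  by rewrite !addnK ?addSn ?subSS ?addnK; ring.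
Qed.

Lemma bracket0_eq0 D a b : (a < l')%N || (b.+1 < m')%N -> vf_bracket H D ord0 a b = 0.
Proof.
move=> ab; rewrite bracket0E.
by do 4 (case: ifP => [|/negbT] ?; try (exfalso; lia)); rewrite !addr0 subr0.
Qed.

Lemma bracket1_eq0 D a b : (a.+1 < l')%N || (b < m')%N -> vf_bracket H D ord_max a b = 0.
Proof.
move=> ab; rewrite bracket1E.
by do 4 (case: ifP => [|/negbT] ?; try (exfalso; lia)); rewrite !addr0 subr0.
Qed.
End BracketCoefficients.

(** * Arithmetic of the kept positions: which of them lie in a given block *)

Section Kept.
Local Open Scope nat_scope.
Variables (l' m' : nat) (cA cB cR cS : nat -> bool).
Hypothesis m_lt_l : m' < l'.
Local Notation l := l'.+1.
Local Notation m := m'.+1.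
Local Notation kept := (kept l m cA cB cR cS).
Local Notation d := (gcdn l m).
Local Notation p := (l %/ d).
Local Notation q := (m %/ d).

Let d_gt0 : 0 < d. Proof. by rewrite gcdn_gt0. Qed.
Let pdE : p * d = l. Proof. by rewrite divnK ?dvdn_gcdl. Qed.
Let qdE : q * d = m. Proof. by rewrite divnK ?dvdn_gcdr. Qed.
Let pqE : d * (p + q) = l + m. Proof. by rewrite mulnC mulnDl pdE qdE. Qed.
Let p_gt0 : 0 < p. Proof. by move: pdE; case: p. Qed.
Let q_gt0 : 0 < q. Proof. by move: qdE; case: q. Qed.

(** [kept] has exponents such as [s * q - 2] with truncated subtraction; as [r] and [s] exceed [d],
    hence 1, nothing is truncated. *)
Let multiples_gt1 r : 1 < r -> 1 < r * p /\ 1 < r * q.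
Proof. by move=> r1; split; apply: leq_trans r1 (leq_pmulr _ _). Qed.

Let resonant_line U V : l * V = m * U -> exists2 r, U = r * p & V = r * q.
Proof.
move=> lVmU; have pVqU : p * V = q * U.
  by apply/eqP; rewrite -(eqn_pmul2r d_gt0) mulnAC pdE lVmU mulnAC qdE.
have pq : coprime p q.
  by rewrite /coprime -(eqn_pmul2r d_gt0) muln_gcdl pdE qdE mul1n.
have : p %| U by rewrite -(Gauss_dvdr _ pq) -pVqU dvdn_mulr.
case/dvdnP=> r UE; exists r => //.
by apply/eqP; rewrite -(eqn_pmul2l p_gt0) pVqU UE; apply/eqP; ring.
Qed.

Let resonant_lineK r : l * (r * q) = m * (r * p).
Proof. by rewrite ![_ * (r * _)]mulnCA muln_divCA_gcd. Qed.

Lemma kept0_left_right a b : l + m <= a + b -> (a < l') || (b.+1 < m') -> kept ord0 a b.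
Proof.
move=> ab /orP[al|bm].
  by rewrite -[b](addKn a); apply: Kept1_left; lia.
by rewrite -[a](addnK b); apply: Kept1_right; lia.
Qed.

Lemma kept1_left_right a b : l + m <= a + b -> (a.+1 < l') || (b < m') ->
    kept ord_max a b.
Proof.
move=> ab /orP[al|bm].
  by rewrite -[b](addKn a); apply: Kept2_left; lia.
by rewrite -[a](addnK b); apply: Kept2_right; lia.
Qed.

(** For targets within reach of the sources the left and right families cannot occur; what remains
    is a border or a resonant line, with the choice read off from the component. *)
Let kept_inv c a b U V : kept c a b ->
  (if c == ord0 then a = U /\ b.+1 = V else a.+1 = U /\ b = V) ->
  l' <= U -> m' <= V ->
  [\/ [/\ V = m', 0 < m' & cA (U - l' - 3) = (c == ord0)],
      U = l' /\ cB (V - m' - 3) = (c == ord0),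
      exists r, [/\ U = r * p, V = r * q & cR r = (c == ord0)] |
      exists s, [/\ U.+1 = s * p, V.+1 = s * q &
        if c == ord0 then m' = 0 \/ cS s else 0 < m' /\ ~~ cS s]].
Proof.
move=> K ab lU mV; move: K ab; case=> /=.
- by move=> k i ? ? [? ?]; exfalso; lia.
- by move=> k j ? ? [? ?]; exfalso; lia.
- move=> i m2 ci [aU bV]; constructor 1; split; [lia|lia|].
  by rewrite (_ : U - l' - 3 = i)//; lia.
- move=> j cj [aU bV]; constructor 2; split; first lia.
  by rewrite (_ : V - m' - 3 = j)//; lia.
- move=> r rd cr [aU bV]; constructor 3; exists r.
  have [rp rq] := multiples_gt1 (leq_trans (leq_add d_gt0 (leqnn 1)) rd).
  by split=> //; lia.
- move=> s sd cs [aU bV]; constructor 4; exists s.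
  have [sp sq] := multiples_gt1 (leq_trans
    (leq_add (leq_add d_gt0 (leqnn 1)) (leq0n _)) sd).
  split; [by rewrite -aU subn1 prednK 1?ltnW|by rewrite -bV -addn2 subnK|].
  by case: cs => [[->]|]; [left|right].
- by move=> k i ? ? [? ?]; exfalso; lia.
- by move=> k j ? ? [? ?]; exfalso; lia.
- move=> i m2 ci [aU bV]; constructor 1; split; [lia|lia|].
  by rewrite (_ : U - l' - 3 = i) ?(negbTE ci)//; lia.
- move=> j cj [aU bV]; constructor 2; split; first lia.
  by rewrite (_ : V - m' - 3 = j) ?(negbTE cj)//; lia.
- move=> r rd cr [aU bV]; constructor 3; exists r.
  have [rp rq] := multiples_gt1 (leq_trans (leq_add d_gt0 (leqnn 1)) rd).
  by rewrite (negbTE cr); split=> //; lia.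
- move=> s sd m2 cs [aU bV]; constructor 4; exists s.
  have [sp sq] := multiples_gt1 (leq_trans
    (leq_add (leq_add d_gt0 (leqnn 1)) (leq0n _)) sd).
  by split; [rewrite -aU -addn2 subnK|rewrite -bV subn1 prednK 1?ltnW|].
Qed.

Lemma kept_degree c a b : kept c a b -> l + m <= a + b.
Proof.
have R_degree r : d + 1 <= r -> l + m + 2 <= r * p + r * q.
  move=> rd; rewrite -mulnDr -pqE; apply: leq_trans (leq_mul rd (leqnn _)).
  by rewrite mulnDl mul1n leq_add2l; exact: (leq_add p_gt0 q_gt0).
have S_degree s : d + 1 + (3 * d - 1) %/ (l + m) <= s -> l + m + 3 <= s * p + s * q.
  move=> sd; have ds : d + 1 <= s by apply: leq_trans sd; apply: leq_addr.
  have : (3 * d - 1) %/ (l + m) < s - d by move: sd; rewrite -addnA; lia.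
  rewrite ltn_divLR; last by rewrite addn_gt0.
  rewrite -pqE mulnCA -mulnDr => sd3.
  (* This surplus of 3 pays for the exponents lost in [s * p - 1] and [s * q - 2]. *)
  have {}sd3 : 3 <= (s - d) * (p + q).
    by rewrite -(leq_pmul2l d_gt0); move: sd3; lia.
  by rewrite -(subnK (leq_trans (leq_addr _ _) ds)) mulnDl; lia.
case=> /=.
- by move=> k i ? ?; lia.
- by move=> k j ? ?; lia.
- by move=> i ? ?; lia.
- by move=> j ?; lia.
- by move=> r /R_degree; lia.
- by move=> s /S_degree; lia.
- by move=> k i ? ?; lia.
- by move=> k j ? ?; lia.
- by move=> i ? ?; lia.
- by move=> j ?; lia.
- by move=> r /R_degree; lia.
- by move=> s /S_degree; lia.
Qed.

(* The block of the perturbation in which [U] and [V] are the exponents of the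
   monomial y_1^U y_2^(V-1) d_1 and of its partner y_1^(U-1) y_2^V d_2. *)
Variables u v : nat.
Hypothesis uv_ge3 : 3 <= u + v.
Local Notation U := (u + l').
Local Notation V := (v + m').
Local Notation kept0 := (kept ord0 U V.-1).
Local Notation kept1 := (kept ord_max U.-1 V).

Let kept0_inv : 0 < V -> kept0 ->
  [\/ [/\ v = 0, 0 < m' & cA (u - 3)], u = 0 /\ cB (v - 3),
      exists r, [/\ U = r * p, V = r * q & cR r] |
      exists s, [/\ U.+1 = s * p, V.+1 = s * q & m' = 0 \/ cS s]].
Proof.
move=> V0 K; have [] := kept_inv (U := U) (V := V) K _ (leq_addl _ _) (leq_addl _ _);
    rewrite /= ?addnK//.
- by rewrite prednK.
- by move=> [vm m0 ->]; constructor 1; split=> //; lia.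
- by move=> [ul ->]; constructor 2; split=> //; lia.
- by move=> ?; constructor 3.
- by move=> ?; constructor 4.
Qed.

Let kept1_inv : kept1 ->
  [\/ [/\ v = 0, 0 < m' & ~~ cA (u - 3)], u = 0 /\ ~~ cB (v - 3),
      exists r, [/\ U = r * p, V = r * q & ~~ cR r] |
      exists s, [/\ U.+1 = s * p, V.+1 = s * q & 0 < m' /\ ~~ cS s]].
Proof.
move=> K; have [] := kept_inv (U := U) (V := V) K _ (leq_addl _ _) (leq_addl _ _);
    rewrite /= ?addnK//.
- by rewrite prednK//; lia.
- by move=> [vm m0 ->]; constructor 1; split=> //; lia.
- by move=> [ul ->]; constructor 2; split=> //; lia.
- by move=> [r [? ? /negbT ?]]; constructor 3; exists r.
- by move=> ?; constructor 4.
Qed.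

(** The number of kept coefficients is the codimension of the image in each case. In [BlockA1], V =
    0 leaves a single target for a single source. In [BlockS], keeping the second coefficient
    requires [0 < m']. *)
Variant block_spec : Prop :=
  | BlockRegular of 0 < u & 0 < v & l * V <> m * U & l * V.+1 <> m * U.+1 &
      ~ kept0 & ~ kept1
  | BlockR of 0 < u & 0 < v & l * V = m * U & (kept0 /\ ~ kept1) \/ (~ kept0 /\ kept1)
  | BlockS of 0 < u & 0 < v & l * V.+1 = m * U.+1 &
      (kept0 /\ ~ kept1) \/ [/\ 0 < m', ~ kept0 & kept1]
  | BlockB of u = 0 & 0 < v & (kept0 /\ ~ kept1) \/ (~ kept0 /\ kept1)
  | BlockA of v = 0 & 0 < u & 0 < m' & (kept0 /\ ~ kept1) \/ (~ kept0 /\ kept1)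
  | BlockA1 of v = 0 & 0 < u & m' = 0 & ~ kept1.

Lemma blockP : block_spec.
Proof.
have [v0|v_gt0] := posnP v.
  have u_gt0 : 0 < u by lia.
  (* On this border V = m' and U >= l' + 3, so lV < mU and l(V+1) < m(U+1); on the border [u = 0]
     both inequalities are reversed. *)
  have notR r : U = r * p -> V = r * q -> False.
    by move=> UE VE; have := resonant_lineK r; rewrite -UE -VE; nia.
  have notS s : U.+1 = s * p -> V.+1 = s * q -> False.
    by move=> UE VE; have := resonant_lineK s; rewrite -UE -VE; nia.
  have [m0|m_gt0] := posnP m'.
    apply: BlockA1 => // /kept1_inv[[]|[]|[r []]|[s []]];
      first [lia | by move=> /notR K /K | by move=> /notS K /K].
  apply: BlockA => //; have [ca|ca] := boolP (cA (u - 3)).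
    left; split.
      have -> : U = (u - 3) + l + 2 by lia.
      by rewrite (_ : V.-1 = m - 2); [apply: Kept1_A; [lia|]|lia].
    case/kept1_inv => [[_ _]|[]|[r []]|[s []]]; first [ lia | by rewrite ca |
        by move=> /notR K /K | by move=> /notS K /K ].
  right; split.
    case/kept0_inv => [|[_ _]|[]|[r []]|[s []]]; first [ lia | by rewrite (negbTE ca) |
        by move=> /notR K /K | by move=> /notS K /K ].
  have -> : U.-1 = (u - 3) + l + 1 by lia.
  by rewrite (_ : V = m - 1); [apply: Kept2_A; [lia|]|lia].
have V0 : 0 < V by lia.
have [u0|u_gt0] := posnP u.
  have notR r : U = r * p -> V = r * q -> False.
    by move=> UE VE; have := resonant_lineK r; rewrite -UE -VE; nia.
  have notS s : U.+1 = s * p -> V.+1 = s * q -> False.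
    by move=> UE VE; have := resonant_lineK s; rewrite -UE -VE; nia.
  apply: BlockB => //; have [cb|cb] := boolP (cB (v - 3)).
    left; split.
      have -> : U = l - 1 by lia.
      by rewrite (_ : V.-1 = m + (v - 3) + 1); [apply: Kept1_B|lia].
    case/kept1_inv => [[]|[_]|[r []]|[s []]]; first [ lia | by rewrite cb |
        by move=> /notR K /K | by move=> /notS K /K ].
  right; split.
    case/kept0_inv => [|[]|[_]|[r []]|[s []]]; first [ lia | by rewrite (negbTE cb) |
        by move=> /notR K /K | by move=> /notS K /K ].
  have -> : U.-1 = l - 2 by lia.
  by rewrite (_ : V = m + (v - 3) + 2); [apply: Kept2_B|lia].
have [lVmU|notR] := eqVneq (l * V) (m * U).
  have [r UE VE] := resonant_line lVmU.
  have notS s : U.+1 = s * p -> V.+1 = s * q -> False.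
    by move=> UE' VE'; have := resonant_lineK s; rewrite -UE' -VE'; lia.
  have rd : d + 1 <= r.
    have : d * (p + q) < r * (p + q) by rewrite pqE mulnDr -UE -VE; lia.
    by rewrite ltn_mul2r addn1 => /andP[].
  have rE r' : U = r' * p -> r' = r.
    by rewrite UE => /eqP; rewrite eqn_pmul2r// => /eqP.
  apply: BlockR => //; have [cr|cr] := boolP (cR r).
    left; split; first by rewrite UE VE -subn1; apply: Kept1_R.
    case/kept1_inv => [[]|[]|[r' []]|[s []]]; [lia|lia| |].
      by move=> /rE-> _; rewrite cr.
    by move=> /notS K /K.
  right; split; last by rewrite UE VE -subn1; apply: Kept2_R.
  case/kept0_inv => [|[]|[]|[r' []]|[s []]]; [lia|lia|lia| |].
    by move=> /rE-> _; rewrite (negbTE cr).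
  by move=> /notS K /K.
have {}notR r : U = r * p -> V = r * q -> False.
  by move=> UE VE; have := resonant_lineK r; rewrite -UE -VE; move/eqP: notR.
have [lVmU|notS] := eqVneq (l * V.+1) (m * U.+1).
  have [s UE VE] := resonant_line lVmU.
  have sd : d + 1 + (3 * d - 1) %/ (l + m) <= s.
    have : 3 <= (s - d) * (p + q) by rewrite mulnBl pqE mulnDr -UE -VE; lia.
    rewrite -(leq_pmul2r d_gt0) -mulnA mulnDl pdE qdE => sdE.
    have : (3 * d - 1) %/ (l + m) < s - d by rewrite ltn_divLR//; lia.
    by lia.
  have sE s' : U.+1 = s' * p -> s' = s.
    by rewrite UE => /eqP; rewrite eqn_pmul2r// => /eqP.
  have U1 : U = s * p - 1 by rewrite -UE subn1.
  have V1 : V = s * q - 1 by rewrite -VE subn1.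
  apply: BlockS => //; have [[m0|cs]|/not_orP[m0 /negP cs]] := pselect (m' = 0 \/ cS s).
  - left; split.
      rewrite U1 (_ : V.-1 = s * q - 2); last by rewrite -VE subn2.
      by apply: Kept1_S => //; left; rewrite m0.
    by case/kept1_inv => [[]|[]|[r []/notR K /K]|[s' [_ _ []]]]; lia.
  - left; split.
      rewrite U1 (_ : V.-1 = s * q - 2); last by rewrite -VE subn2.
      by apply: Kept1_S => //; right.
    case/kept1_inv => [[]|[]|[r []/notR K /K]|[s' [/sE -> _ []]]]; [lia|lia|by []|].
    by rewrite cs.
  - right; split; [lia| |].
      case/kept0_inv => [|[]|[]|[r []/notR K /K]|[s' [/sE -> _ []]]];
          [lia|lia|lia|by []|lia|].
      by rewrite (negbTE cs).
    rewrite V1 (_ : U.-1 = s * p - 2); last by rewrite -UE subn2.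
    by apply: Kept2_S => //; lia.
have {}notS s : U.+1 = s * p -> V.+1 = s * q -> False.
  by move=> UE VE; have := resonant_lineK s; rewrite -UE -VE; move/eqP: notS.
apply: BlockRegular => //.
- by move=> /resonant_line[r UE VE]; apply: notR UE VE.
- by move=> /resonant_line[r UE VE]; apply: notS UE VE.
- by case/kept0_inv => [|[]|[]|[r []/notR K /K]|[s []/notS K /K]]; lia.
- by case/kept1_inv => [[]|[]|[r []/notR K /K]|[s []/notS K /K]]; lia.
Qed.
End Kept.

(** * Solving the homological equation block by block *)

Section Homological.
Variables (K : fieldType) (l' m' : nat) (cA cB cR cS : nat -> bool).
Hypothesis K_char0 : [pchar K] =i pred0.
Hypothesis m_lt_l : (m' < l')%N.
Local Notation l := l'.+1.
Local Notation m := m'.+1.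
Local Notation kept := (kept l m cA cB cR cS).
Local Notation H := (unperturbed K l m).

Let natr_neq0 n : (0 < n)%N -> n%:R != 0 :> K.
Proof. by rewrite ((pcharf0P K).1 K_char0) lt0n. Qed.

Let natr_inj (a b : nat) : a%:R = b%:R :> K -> a = b.
Proof.
wlog ab : a b / (a <= b)%N.
  by move=> W; have [/W//|/ltnW/W ba /esym/ba] := leqP a b.
move=> /esym/eqP; rewrite -subr_eq0 -natrB// ((pcharf0P K).1 K_char0) subn_eq0 => ba.
by apply/eqP; rewrite eqn_leq ab.
Qed.

(** The determinant of [block_out0] and [block_out1] is (w + m l')(w - l m') + l l' m m', and this
    equals w (w + l - m). *)
Definition block_weight (u v : nat) : K := (l * (v + m'))%:R - (m * (u + l'))%:R.
Definition block_out0 u v (x y : K) :=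
  (block_weight u v + (m * l')%:R) * x + (m * m')%:R * y.
Definition block_out1 u v (x y : K) :=
  - (l * l')%:R * x + (block_weight u v - (l * m')%:R) * y.

Section Block.
Variables u v : nat.
Hypothesis uv_ge3 : (3 <= u + v)%N.
Local Notation U := (u + l')%N.
Local Notation V := (v + m')%N.
Local Notation kept0 := (kept ord0 U V.-1).
Local Notation kept1 := (kept ord_max U.-1 V).

Local Notation w := (block_weight u v).
Local Notation out0 := (block_out0 u v).
Local Notation out1 := (block_out1 u v).

Let wE : w + l%:R - m%:R = (l * V.+1)%:R - (m * U.+1)%:R.
Proof. by rewrite /block_weight; ring. Qed.

Let w_resonant1 : (l * V = m * U)%N -> w = 0.
Proof. by rewrite /block_weight => ->; rewrite subrr. Qed.

Let w_resonant2 : (l * V.+1 = m * U.+1)%N -> w = m%:R - l%:R.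
Proof.
move=> lVmU; move: wE; rewrite lVmU subrr => w0.
by rewrite -[RHS]add0r -w0; ring.
Qed.

Let c00_B : u = 0%N -> w + (m * l')%:R = (l * V)%:R.
Proof. by rewrite /block_weight => ->; ring. Qed.

Let c00_S : w = m%:R - l%:R -> w + (m * l')%:R = (l * m')%:R.
Proof. by move->; ring. Qed.

Let c11_A : v = 0%N -> w - (l * m')%:R = - (m * U)%:R.
Proof. by rewrite /block_weight => ->; ring. Qed.

Let c10_neq0 : - (l * l')%:R != 0 :> K.
Proof. by rewrite oppr_eq0 natr_neq0//; lia. Qed.

Let c11_neq0 : v = 0%N -> w - (l * m')%:R != 0.
Proof. by move=> v0; rewrite c11_A// oppr_eq0 natr_neq0//; lia. Qed.

(** These are the cases where the second coefficient may be kept and the first equation has to be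
    solved by [x] alone; on the second line the factor is l m', hence the condition on [m']. *)
Let c00_neq0 : [\/ w = 0, w = m%:R - l%:R /\ (0 < m')%N | u = 0%N] ->
    w + (m * l')%:R != 0.
Proof.
case=> [->|[w0 m0]|u0].
- by rewrite add0r natr_neq0//; lia.
- by rewrite c00_S// natr_neq0//; lia.
- by rewrite c00_B// natr_neq0//; lia.
Qed.

Let c01_neq0 : (0 < m')%N -> (m * m')%:R != 0 :> K.
Proof. by move=> ?; rewrite natr_neq0//; lia. Qed.

(** A kept coefficient removes one equation, and the other is solved with a single unknown. The
    guard [0 < V] matters because at V = 0 the truncated [V.-1] points to a position of another
    block. *)
Lemma block_solve (W0 W1 : K) : exists x y,
  [/\ v = 0%N -> x = 0, u = 0%N -> y = 0,
      (0 < V)%N -> ~ kept0 -> out0 x y = W0 &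
      ~ kept1 -> out1 x y = W1].
Proof.
have solve0x : (0 < v)%N -> w + (m * l')%:R != 0 -> kept1 -> exists x y,
    [/\ v = 0%N -> x = 0, u = 0%N -> y = 0,
      (0 < V)%N -> ~ kept0 -> out0 x y = W0 & ~ kept1 -> out1 x y = W1].
  move=> v_gt0 c_neq0 k1; exists (W0 / (w + (m * l')%:R)), 0; split=> //; first lia.
  by move=> _ _; rewrite /block_out0 mulr0 addr0 mulrC divfK.
have solve1x : (0 < v)%N -> kept0 -> exists x y,
    [/\ v = 0%N -> x = 0, u = 0%N -> y = 0,
      (0 < V)%N -> ~ kept0 -> out0 x y = W0 & ~ kept1 -> out1 x y = W1].
  move=> v_gt0 k0; exists (W1 / - (l * l')%:R), 0; split=> //; first lia.
  by move=> _; rewrite /block_out1 mulr0 addr0 mulrC divfK.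
have solve1y : (0 < u)%N -> v = 0%N -> ((0 < V)%N -> kept0) -> exists x y,
    [/\ v = 0%N -> x = 0, u = 0%N -> y = 0,
      (0 < V)%N -> ~ kept0 -> out0 x y = W0 & ~ kept1 -> out1 x y = W1].
  move=> u_gt0 v0 k0; exists 0, (W1 / (w - (l * m')%:R)); split=> //; first lia.
    by move=> /k0 + /[dup].
  by move=> _; rewrite /block_out1 mulr0 add0r mulrC divfK// c11_neq0.
case: (blockP cA cB cR cS m_lt_l uv_ge3).
- move=> u0 v0 /eqP w1 /eqP w2 _ _.
  have w_neq0 : w != 0 by apply: contraNneq w1 => /subr0_eq/natr_inj/eqP.
  have w'_neq0 : w + l%:R - m%:R != 0.
    by rewrite wE; apply: contraNneq w2 => /subr0_eq/natr_inj/eqP.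
  (* Cramer's rule. *)
  exists (((w - (l * m')%:R) * W0 - (m * m')%:R * W1) / (w * (w + l%:R - m%:R))).
  exists (((w + (m * l')%:R) * W1 + (l * l')%:R * W0) / (w * (w + l%:R - m%:R))).
  split=> [||_ _|_]; try lia; rewrite /block_out0 /block_out1; field;
    by rewrite w_neq0 andbT !nat1r.
- move=> u0 v0 /w_resonant1 w0 [[k0 _]|[_ k1]]; first exact: solve1x.
  by apply: solve0x => //; apply: c00_neq0; constructor 1.
- move=> u0 v0 /w_resonant2 w0 [[k0 _]|[m0 _ k1]]; first exact: solve1x.
  by apply: solve0x => //; apply: c00_neq0; constructor 2.
- move=> u0 v0 [[k0 _]|[_ k1]]; first exact: solve1x.
  by apply: solve0x => //; apply: c00_neq0; constructor 3.
- move=> v0 u0 m0 [[k0 _]|[_ k1]]; first exact: solve1y.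
  exists 0, (W0 / (m * m')%:R); split=> //; first lia.
  by move=> _ _; rewrite /block_out0 mulr0 add0r mulrC divfK// c01_neq0.
- by move=> v0 u0 m0 _; apply: solve1y => //; lia.
Qed.

(** On a resonant line the two outputs satisfy a linear relation in which the kept one has a nonzero
    factor, so it vanishes with the other. On a border the only source coefficient is forced to be
    0. *)
Lemma block_disjoint (x y : K) :
  (v = 0%N -> x = 0) -> (u = 0%N -> y = 0) ->
  ((0 < V)%N -> ~ kept0 -> out0 x y = 0) -> (~ kept1 -> out1 x y = 0) ->
  ((0 < V)%N -> out0 x y = 0) /\ out1 x y = 0.
Proof.
move=> x0 y0 O0 O1.
have proportional (a b : K) : a * out0 x y + b * out1 x y = 0 ->
    (a != 0 -> out1 x y = 0 -> out0 x y = 0) /\ (b != 0 -> out0 x y = 0 -> out1 x y = 0).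
  move=> ab; split=> [a0 o|b0 o]; move: ab; rewrite o mulr0 ?addr0 ?add0r => /eqP.
    by rewrite mulf_eq0 (negbTE a0) => /eqP.
  by rewrite mulf_eq0 (negbTE b0) => /eqP.
have all0 : x = 0 -> y = 0 -> ((0 < V)%N -> out0 x y = 0) /\ out1 x y = 0.
  by move=> -> ->; rewrite /block_out0 /block_out1 !mulr0 !addr0.
case: (blockP cA cB cR cS m_lt_l uv_ge3).
- by move=> u0 v0 _ _ n0 n1; split=> [V0|]; [apply: O0|apply: O1].
- move=> u0 v0 /w_resonant1 w0 k.
  have lin : l%:R * out0 x y + m%:R * out1 x y = 0.
    by rewrite /block_out0 /block_out1 w0; ring.
  have [P0 P1] := proportional _ _ lin.
  case: k => [[_ /O1 o1]|[/O0 o0 _]]; first by split=> // _; apply: P0 => //; apply: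
      natr_neq0.
  by split=> //; apply: P1; [apply: natr_neq0|apply: o0; lia].
- move=> u0 v0 /w_resonant2 w0 k.
  have lin : l'%:R * out0 x y + m'%:R * out1 x y = 0.
    by rewrite /block_out0 /block_out1 w0; ring.
  have [P0 P1] := proportional _ _ lin.
  case: k => [[_ /O1 o1]|[m0 /O0 o0 _]].
    by split=> // _; apply: P0 => //; apply: natr_neq0; lia.
  by split=> //; apply: P1; [apply: natr_neq0|apply: o0; lia].
- move=> u0 v0 k; have {}y0 := y0 u0; apply: all0 => //.
  case: k => [[_ /O1]|[/O0 O _]]; last (have /O : (0 < V)%N by lia).
    by rewrite /block_out1 y0 mulr0 addr0 => /eqP;
        rewrite mulf_eq0 (negbTE c10_neq0) => /eqP.
  rewrite /block_out0 y0 mulr0 addr0 => /eqP; rewrite mulf_eq0 (negbTE (c00_neq0 _)) =>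
      [/eqP//|].
  by constructor 3.
- move=> v0 u0 m0 k; have {}x0 := x0 v0; apply: all0 => //.
  case: k => [[_ /O1]|[/O0 O _]]; last (have /O : (0 < V)%N by lia).
    by rewrite /block_out1 x0 mulr0 add0r => /eqP;
        rewrite mulf_eq0 (negbTE (c11_neq0 v0)) => /eqP.
  by rewrite /block_out0 x0 mulr0 add0r => /eqP;
      rewrite mulf_eq0 (negbTE (c01_neq0 m0)) => /eqP.
- move=> v0 u0 m0 /O1 o1; have {}x0 := x0 v0; apply: all0 => //; move: o1.
  by rewrite /block_out1 x0 mulr0 add0r => /eqP;
      rewrite mulf_eq0 (negbTE (c11_neq0 v0)) => /eqP.
Qed.
End Block.

Lemma ord2P (c : 'I_2) : c = ord0 \/ c = ord_max.
Proof. by case: c => -[|[|//]] ?; [left|right]; apply: val_inj. Qed.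

Lemma homological_solvable k (W : vfps2 K) : exists D : vfps2 K,
  (forall c a b, (a + b)%N <> k.+2 -> D c a b = 0) /\
  (forall c a b, (a + b)%N = (k + (l + m))%N -> ~ kept c a b ->
     vf_bracket H D c a b = W c a b).
Proof.
(* In a fixed degree [u] determines [v], so the blocks are indexed by [u] alone and solved
   independently. *)
have /choice [z zP] u : exists xy : K * K, forall v, (u + v)%N = k.+3 ->
    [/\ v = 0%N -> xy.1 = 0, u = 0%N -> xy.2 = 0,
      (0 < v + m')%N -> ~ kept ord0 (u + l') (v + m').-1 ->
        block_out0 u v xy.1 xy.2 = W ord0 (u + l')%N (v + m').-1 &
      ~ kept ord_max (u + l').-1 (v + m') ->
        block_out1 u v xy.1 xy.2 = W ord_max (u + l').-1 (v + m')%N].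
  have [uk|ku] := leqP u k.+3; last by exists 0 => v; lia.
  have uv3 : (3 <= u + (k.+3 - u))%N by lia.
  have [x [y xyP]] := block_solve uv3 (W ord0 (u + l')%N (k.+3 - u + m').-1)
    (W ord_max (u + l').-1 (k.+3 - u + m')%N).
  by exists (x, y) => v uv; rewrite (_ : v = (k.+3 - u)%N)//; lia.
(* The shift to [z a.+1] is due to the second source of block [u] being y_1^(u-1) y_2^v d_2. *)
pose D : vfps2 K := fun c a b =>
  if (a + b == k.+2)%N then if c == ord0 then (z a).1 else (z a.+1).2 else 0.
have D1 u v : (u + v)%N = k.+3 -> first_coef D u v = (z u).1.
  case: v => [|v] uv /=; first by have [->] := zP u _ uv.
  by rewrite /D /= ifT//; lia.
have D2 u v : (u + v)%N = k.+3 -> second_coef D u v = (z u).2.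
  case: u => [|u] uv /=; first by have [_ ->] := zP _ _ uv.
  by rewrite /D /= ifT//; lia.
exists D; split=> [c a b ab|c a b ab nk]; first by rewrite /D; case: eqP.
case: (ord2P c) nk => -> nk.
  have ab_hit : ~~ ((a < l') || (b.+1 < m'))%N.
    by apply/negP => /(kept0_left_right cA cB cR cS) K0; apply: nk; apply: K0; lia.
  pose u := (a - l')%N; pose v := (b.+1 - m')%N.
  have aE : a = (u + l')%N by lia.
  have bE : b.+1 = (v + m')%N by lia.
  have uv : (u + v)%N = k.+3 by lia.
  have [_ _ O _] := zP u v uv; rewrite -aE -bE in O.
  by rewrite (bracket0_coef _ aE bE) D1// D2//; apply: O.
have ab_hit : ~~ ((a.+1 < l') || (b < m'))%N.
  by apply/negP => /(kept1_left_right cA cB cR cS) K1; apply: nk; apply: K1; lia.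
pose u := (a.+1 - l')%N; pose v := (b - m')%N.
have aE : a.+1 = (u + l')%N by lia.
have bE : b = (v + m')%N by lia.
have uv : (u + v)%N = k.+3 by lia.
have [_ _ _ O] := zP u v uv; rewrite -aE -bE in O.
by rewrite (bracket1_coef _ aE bE) D1// D2//; apply: O.
Qed.

Lemma homological_disjoint k (D : vfps2 K) :
  (forall c a b, (a + b)%N = (k + (l + m))%N -> ~ kept c a b ->
      vf_bracket H D c a b = 0) ->
  forall c a b, (a + b)%N = (k + (l + m))%N -> vf_bracket H D c a b = 0.
Proof.
move=> D0.
have block u v : (u + v)%N = k.+3 ->
    ((0 < v + m')%N -> vf_bracket H D ord0 (u + l')%N (v + m').-1 = 0) /\
    vf_bracket H D ord_max (u + l').-1 (v + m')%N = 0.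
  move=> uv; have uv3 : (3 <= u + v)%N by lia.
  have U0 : (u + l').-1.+1 = (u + l')%N by lia.
  have O1 := bracket1_coef D U0 (erefl (v + m')%N).
  have [V0|V0] := leqP (v + m') 0.
    have := @block_disjoint u v uv3 (first_coef D u v) (second_coef D u v).
    case => //.
    - by case: (v) V0.
    - by move=> ->.
    - lia.
    - by move=> n1; rewrite -[LHS]O1 D0//; lia.
    - by move=> _ o1; rewrite O1; split=> //; lia.
  have O0 := bracket0_coef D (erefl (u + l')%N) (prednK V0).
  have := @block_disjoint u v uv3 (first_coef D u v) (second_coef D u v).
  case.
  - by move=> ->.
  - by move=> ->.
  - by move=> _ n0; rewrite -[LHS]O0 D0//; lia.
  - by move=> n1; rewrite -[LHS]O1 D0//; lia.
  - by move=> o0 o1; rewrite O0 O1; split; [move=> _; exact: (o0 V0)|exact: o1].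
move=> c a b ab; case: (ord2P c) => ->.
  have [|hit] := boolP ((a < l') || (b.+1 < m'))%N; first exact: bracket0_eq0.
  have [|+ _] := block (a - l')%N (b.+1 - m')%N; first lia.
  by rewrite !subnK//; [apply; lia|lia|lia].
have [|hit] := boolP ((a.+1 < l') || (b < m'))%N; first exact: bracket1_eq0.
have [|_] := block (a.+1 - l')%N (b - m')%N; first lia.
by rewrite !subnK//; lia.
Qed.
End Homological.

(** * The result over any field of characteristic zero, which covers real and complex scalars at
    once *)

Theorem corollary2_char0 (K : fieldType) (l m : nat) (cA cB cR cS : nat -> bool) :
  [pchar K] =i pred0 -> (1 <= m)%N -> (m < l)%N ->
  let chi := (l + m - 2)%N in
  let H := unperturbed K l m in
  let S := kept l m cA cB cR cS in
  resonant_set H chi S /\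
  forall X : vfps2 K, ord_ge chi.+1 X ->
    exists Q Y : vfps2 K,
      [/\ ord_ge 1 Q,
          transforms_into (vfps_add H X) Q (vfps_add H Y),
          ord_ge chi.+1 Y &
          forall c a b, ~ S c a b -> Y c a b = 0].
Proof.
move=> K0; case: m => // m' _; case: l => // l' ml chi H S.
have chiE : chi.+2 = (l'.+1 + m'.+1)%N by rewrite /chi; lia.
split; last first.
  apply: (normal_form_exists (h := fun c => if c == ord0 then - m'.+1%:R else l'.+1%:R)
    (p := fun c => if c == ord0 then l'.+1 else l')
    (q := fun c => if c == ord0 then m' else m'.+1)).
  - by move=> c; rewrite /H /unperturbed; case: ifP.
  - by move=> c; case: ifP => _; lia.
  - by move=> k W; rewrite chiE; apply: homological_solvable.
split=> [c a b k|[//|k] _]; first by rewrite chiE; apply: kept_degree k.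
(* Resonance degrees start at 1, whereas the degree parameter of the block lemmas starts at 0. *)
have degE : (k.+1 + chi).+1 = (k + (l'.+1 + m'.+1))%N by rewrite -chiE; lia.
apply: resonant_positions => [W|D _]; rewrite degE.
  exact: homological_solvable.
exact: homological_disjoint.
Qed.

Theorem corollary2 (R : realType) (s : scalar_kind) (l m : nat)
    (m_ge1 : (1 <= m)%N) (m_lt_l : (m < l)%N)
    (cA cB cR cS : nat -> bool) :
  let K := scalars R s in
  let chi := (l + m - 2)%N in
  let H := unperturbed K l m in
  let S := kept l m cA cB cR cS in
  resonant_set H chi S /\
  forall X : vfps2 K, ord_ge chi.+1 X ->
    exists Q Y : vfps2 K,
      [/\ ord_ge 1 Q,
          transforms_into (vfps_add H X) Q (vfps_add H Y),
          ord_ge chi.+1 Y &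
          forall c a b, ~ S c a b -> Y c a b = 0].
Proof. by apply: corollary2_char0 => //; case: s; apply: Num.Theory.pchar_num. Qed.
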